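(* Let $c = 0.21$. Whenever $f$ and $g$ are functions analytic in the unit disk $\mathbb{D}$ that satisfy $|f(z)| \leq |g(z)|$ for all $z$ with $c < |z| < 1$, then $\|f\| \leq \|g\|$.
   Context: $\mathbb{D} = \{z \in \mathbb{C} : |z| < 1\}$ is the open unit disk. For $f$ analytic in $\mathbb{D}$, $\|f\| = \left\{ \frac{1}{\pi} \int_{\mathbb{D}} |f(z)|^2 \, dA(z) \right\}^{1/2}$ (the Bergman space $A^2$ norm), where $dA$ denotes Lebesgue area measure. The value of $\|f\|$ may be $+\infty$, and the inequality is understood in $[0, \infty]$. *)

(* Defs.v *)
From mathcomp Require Import all_boot all_order all_algebra.
From mathcomp Require Export complex.
From mathcomp Require Export all_classical all_reals all_analysis.
Import Order.TTheory GRing.Theory Num.Theory.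
Import numFieldNormedType.Exports.
Import Normc.

Set Implicit Arguments.
Unset Strict Implicit.
Unset Printing Implicit Defensive.

Local Open Scope classical_set_scope.
Local Open Scope complex_scope.
Local Open Scope ring_scope.

(* [normc] is the modulus as an element of [R]; it satisfies
   [`|z| = (normc z)%:C]. *)
Definition unit_disk (R : realType) : set R[i] := [set z | normc z < 1].

(* Complex differentiability at every point of the disk: [R[i]^o] is [R[i]] as
   a normed space over itself, so the increment in [derivable] is a complex
   number. *)
Definition analytic_in_disk (R : realType) (f : R[i] -> R[i]) : Prop :=
  forall z, unit_disk z -> derivable (f : R[i]^o -> R[i]^o) z 1.

(* Area measure is the product Lebesgue measure on [R * R], identified with the
   complex plane. The value may be [+oo], as [+oo `^ 2^-1 = +oo]. *)
Definition bergman_norm (R : realType) (f : R[i] -> R[i]) : \bar R :=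
  (((pi^-1)%:E *
    \int[@lebesgue_measure R \x @lebesgue_measure R]_(p in
       [set p : R * R | unit_disk (p.1 +i* p.2)])
      (normc (f (p.1 +i* p.2)) ^+ 2)%:E) `^ 2^-1)%E.

(* Main.v *)
Require Import Defs.
From HB Require Import structures.
From mathcomp Require Import all_boot all_order all_algebra.
From mathcomp Require Import complex.
From mathcomp Require Import all_classical all_reals all_analysis.
From mathcomp Require Import measurable_realfun ring lra.
Import Order.TTheory GRing.Theory Num.Theory.
Import numFieldNormedType.Exports.
Import Normc.
Set Implicit Arguments.
Unset Strict Implicit.
Unset Printing Implicit Defensive.
Local Open Scope classical_set_scope.
Local Open Scope ring_scope.

Local Notation Re := complex.Re.
Local Notation Im := complex.Im.

(* Put [c = 21/100] and, for a point [p] with [|p|^2 = c], let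
   [W_p z = f z * g p - g z * f p] and [gap z = |g z|^2 - |f z|^2]. Scaling [f]
   by a constant below 1, one may assume [gap p > 0] and [gap (- p) > 0] for some
   such [p], unless [g = 0]. Consider [E z = W_p z * W_(-p) z], which is analytic
   in the whole disc, and [k = sqrt (gap p * gap (- p))].
   - The identity |g z conj(g p) - f z conj(f p)|^2 = |W_p z|^2 + gap z * gap p
     gives [- k * gap z <= |E z|] everywhere, in particular for [|z| <= c].
   - On the annulus [c < |z| < 1] the quotient [f / g] is bounded by 1, and the
     Schwarz-Pick inequality on the universal cover of the annulus (a strip)
     bounds [|W_p|] and [|W_(-p)|]. Multiplying the two bounds gives
     [|E z| <= N * k * gap z] for [0.3 <= |z| <= 0.7], with [N = 0.4 / 0.0441].
   - The mean of [|E|] over [|z| <= r] is nondecreasing in [r]. Comparing the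
     radii [0.21], [0.3] and [0.7],
     [N * int_(|z| <= 0.21) |E| <= int_(0.3 < |z| <= 0.7) |E|].
   Together these give [0 <= int gap] over the union of [|z| <= 0.21] and
   [0.3 < |z| <= 0.7]; elsewhere [gap >= 0] by assumption.

   Cauchy's theorem enters only through the maximum principle, which is obtained
   from Goursat's bisection on rectangles in logarithmic coordinates. The
   monotonicity of the means follows from the maximum principle applied to sums
   of rotated copies of [E] with unimodular coefficients. *)

(** The obstacle is that [f / g] may have poles where [|z| <= c], so it cannot be followed into that
    disc. The wronskian clears the denominators: it is analytic in the whole disc and still
    controlled by Schwarz-Pick on the annulus. A single base point gives a bound that deteriorates
    with the angle between [z] and [p]. For [p] and [- p] the two angular distances add up to pi, so
    the product of the two bounds is controlled uniformly in the angle. The choice [|p|^2 = c] puts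
    the logarithms of [p] and [- p] on the midline of the strip. The radii satisfy
    [0.3 * 0.7 = 0.21], so their annulus is invariant under [|z| -> c / |z|], which reflects the
    strip in that midline, and both boundary circles give the same bound. The constant
    [N = (0.7^2 - 0.3^2) / 0.21^2] is the ratio of the areas of the annulus and of the small disc,
    which is what growing means of [|E|] yield. The numerical margin is thin: [11.695] against
    [11.7] at the critical angle. *)

Definition holo {R : realType} (f : R[i] -> R[i]) (z : R[i]) : Prop :=
  derivable (f : R[i]^o -> R[i]^o) z 1.

(** Radius and tolerance are real numbers, whereas the norm of [R[i]^o] takes its values in [R[i]];
    [ccontP] links the two. *)
Definition ccont {R : realType} (f : R[i] -> R[i]) (z : R[i]) : Prop :=
  forall e : R, 0 < e ->
  exists2 r : R, 0 < r & forall w, normc (w - z) < r -> normc (f w - f z) < e.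

(** * Modulus, real and imaginary parts, complex differentiability *)

Section complex_kit.
Context {R : realType}.
Implicit Types (z w : R[i]) (f g : R[i] -> R[i]) (x y e : R).

Lemma normc_ge0 z : 0 <= normc z.
Proof. by case: z => a b /=; exact: sqrtr_ge0. Qed.

Lemma sqr_normcE z : normc z ^+ 2 = Re z ^+ 2 + Im z ^+ 2.
Proof. by case: z => a b /=; rewrite sqr_sqrtr// addr_ge0// sqr_ge0. Qed.

Lemma norm_normc z : `|z| = (normc z)%:C%C.
Proof. by rewrite normc_def; case: z. Qed.

Lemma normc_eq0 z : (normc z == 0) = (z == 0).
Proof. by apply/eqP/eqP => [/eq0_normc//|->]; rewrite normc0. Qed.

Lemma normc_gt0 z : (0 < normc z) = (z != 0).
Proof. by rewrite lt_def normc_eq0 normc_ge0 andbT. Qed.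

Lemma normcBC z w : normc (z - w) = normc (w - z).
Proof. by rewrite -normcN opprB. Qed.

Lemma le_normcB z w : normc (z - w) <= normc z + normc w.
Proof. by rewrite -(normcN w) le_normcD. Qed.

Lemma normc_le_dist z w : normc z <= normc w + normc (z - w).
Proof. by rewrite -{1}(subrKC w z) le_normcD. Qed.

Lemma dist_normc z w : `|normc z - normc w| <= normc (z - w).
Proof.
have h1 := normc_le_dist z w; have h2 := normc_le_dist w z.
by rewrite normcBC in h2; rewrite ler_norml; apply/andP; split; lra.
Qed.

Lemma normc_real x : normc (x%:C)%C = `|x|.
Proof. by rewrite /= expr0n/= addr0 sqrtr_sqr. Qed.

Lemma Re_le_normc z : `|Re z| <= normc z.
Proof.
by case: z => a b /=; rewrite -sqrtr_sqr ler_sqrt ?lerDl ?sqr_ge0//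
  addr_ge0 ?sqr_ge0.
Qed.

Lemma Im_le_normc z : `|Im z| <= normc z.
Proof.
by case: z => a b /=; rewrite -sqrtr_sqr ler_sqrt ?lerDr ?sqr_ge0//
  addr_ge0 ?sqr_ge0.
Qed.

Lemma normc_le_ReIm z : normc z <= `|Re z| + `|Im z|.
Proof.
rewrite -(ler_pXn2r (n := 2)) ?nnegrE ?normc_ge0 ?addr_ge0//.
rewrite sqr_normcE sqrrD -!normrX !(ger0_norm (sqr_ge0 _)) lerD2r lerDl.
by rewrite mulrn_wge0 // mulr_ge0.
Qed.

Lemma ReD z w : Re (z + w) = Re z + Re w. Proof. by case: z; case: w. Qed.
Lemma ImD z w : Im (z + w) = Im z + Im w. Proof. by case: z; case: w. Qed.
Lemma ReN z : Re (- z) = - Re z. Proof. by case: z. Qed.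
Lemma ImN z : Im (- z) = - Im z. Proof. by case: z. Qed.
Lemma ReM z w : Re (z * w) = Re z * Re w - Im z * Im w.
Proof. by case: z; case: w. Qed.
Lemma ImM z w : Im (z * w) = Re z * Im w + Im z * Re w.
Proof. by case: z; case: w. Qed.
Definition ReImE := (ReD, ImD, ReN, ImN, ReM, ImM).

Lemma normcX z n : normc (z ^+ n) = normc z ^+ n.
Proof.
by elim: n => [|n IH]; rewrite ?expr0 ?normc1// !exprS normcM IH.
Qed.

Lemma normc_sum (I : Type) (s : seq I) (F : I -> R[i]) :
  normc (\sum_(i <- s) F i) <= \sum_(i <- s) normc (F i).
Proof.
elim/big_ind2 : _ => //; first by rewrite normc0.
by move=> a b c d h1 h2; rewrite (le_trans (le_normcD _ _)) ?lerD.
Qed.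

Lemma complex_pos (e : R[i]) : 0 < e -> exists2 x : R, 0 < x & e = (x%:C)%C.
Proof.
by case: e => a b; rewrite ltcE /= => /andP[/eqP -> a0]; exists a.
Qed.

Lemma ccontP f z : ccont f z <-> 
  (f : R[i]^o -> R[i]^o) w @[w --> (z : R[i]^o)] --> (f z : R[i]^o).
Proof.
split=> [cf|cf].
  apply/(@cvgrPdist_lt R[i] R[i]^o _ _ (nbhs_filter (z : R[i]^o))) => _ /complex_pos[e e0 ->].
  have [r r0 rf] := cf _ e0.
  apply/(@nbhs_normP R[i] R[i]^o); exists (r%:C)%C => /=; first by rewrite ltcR.
  move=> w /=; rewrite norm_normc ltcR normcBC => /rf.
  by rewrite norm_normc ltcR normcBC.
move=> e e0; move/(@cvgrPdist_lt R[i] R[i]^o _ _ (nbhs_filter (z : R[i]^o))) : cf => /(_ (e%:C)%C).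
rewrite ltcR => /(_ e0) /(@nbhs_normP R[i] R[i]^o)[_ /= /complex_pos[r r0 ->] rf].
exists r => // w wz; have := rf w; rewrite /= !norm_normc !ltcR.
by rewrite (normcBC z) (normcBC (f z)) => /(_ wz).
Qed.

(** The difference quotient is multiplied out, so that [w = z] needs no exception and the tolerances
    are real. *)
Lemma holoP f z : holo f z <-> exists d : R[i], forall e, 0 < e ->
  exists2 r : R, 0 < r & forall w, normc (w - z) < r ->
    normc (f w - f z - d * (w - z)) <= e * normc (w - z).
Proof.
split.
  move=> /cvg_ex[d /(@cvgrPdist_le R[i] R[i]^o _ _ (dnbhs_filter (0 : R[i]^o))) dd]; exists d => e e0.
  have := dd (e%:C)%C; rewrite ltcR => /(_ e0).
  rewrite near_withinE => /(@nbhs_normP R[i] R[i]^o)[_ /= /complex_pos[r r0 ->] rf].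
  exists r => // w wz; have [->|wnz] := eqVneq w z.
    by rewrite !subrr mulr0 subrr !normc0 mulr0.
  have := rf (w - z); rewrite /= sub0r normrN norm_normc ltcR => /(_ wz).
  rewrite subr_eq0 => /(_ wnz); rewrite /shift/= /GRing.scale/= mulr1 subrK.
  rewrite norm_normc lecR => H.
  have wz0 : w - z != 0 by rewrite subr_eq0.
  have -> : f w - f z - d * (w - z) = - (d - (w - z)^-1 * (f w - f z)) * (w - z).
    by rewrite mulNr mulrBl mulrAC mulVf// mul1r opprB.
  by rewrite normcM normcN ler_wpM2r ?normc_ge0.
move=> [d dd]; apply/cvg_ex; exists d.
apply/(@cvgrPdist_le R[i] R[i]^o _ _ (dnbhs_filter (0 : R[i]^o))).
move=> _ /complex_pos[e e0 ->].
have [r r0 rf] := dd e e0.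
rewrite near_withinE; apply/(@nbhs_normP R[i] R[i]^o); exists (r%:C)%C => /=.
  by rewrite ltcR.
move=> h /=; rewrite sub0r normrN norm_normc ltcR => hr h0.
rewrite /shift/= /GRing.scale/= mulr1 norm_normc lecR.
have := rf (h + z); rewrite addrK => /(_ hr) H.
have -> : d - h^-1 * (f (h + z) - f z) = - (f (h + z) - f z - d * h) * h^-1.
  by rewrite mulNr mulrBl mulfK// opprB mulrC [RHS]addrC addrC [X in _ - X]mulrC.
by rewrite normcM normcN normcV ler_pdivrMr// normc_gt0.
Qed.

Lemma holo_ccont f z : holo f z -> ccont f z.
Proof. by move=> /derivable1_diffP /differentiable_continuous /ccontP. Qed.

Lemma holo_cst (a : R[i]) z : holo (fun _ => a) z.
Proof. exact: derivable_cst. Qed.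

Lemma holo_id z : holo id z.
Proof. exact: derivable_id. Qed.

Lemma holoD f g z : holo f z -> holo g z -> holo (fun w => f w + g w) z.
Proof. exact: derivableD. Qed.

Lemma holoN f z : holo f z -> holo (fun w => - f w) z.
Proof. exact: derivableN. Qed.

Lemma holoB f g z : holo f z -> holo g z -> holo (fun w => f w - g w) z.
Proof. exact: derivableB. Qed.

Lemma holoM f g z : holo f z -> holo g z -> holo (fun w => f w * g w) z.
Proof. exact: derivableM. Qed.

Lemma holoX f z n : holo f z -> holo (fun w => f w ^+ n) z.
Proof.
move=> hf; elim: n => [|n IH].
  by under eq_fun do rewrite expr0; exact: holo_cst.
by under eq_fun do rewrite exprS; exact: holoM.
Qed.

Lemma holoV f z : f z != 0 -> holo f z -> holo (fun w => (f w)^-1) z.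
Proof.
by move=> fz /derivable1_diffP hf; apply/derivable1_diffP/differentiableV.
Qed.

Lemma holo_comp f g z : holo f z -> holo g (f z) -> holo (fun w => g (f w)) z.
Proof.
move=> /derivable1_diffP hf /derivable1_diffP hg; apply/derivable1_diffP.
exact: (differentiable_comp hf hg).
Qed.

Lemma holo_sum (I : Type) (s : seq I) (F : I -> R[i] -> R[i]) z :
  (forall i, holo (F i) z) -> holo (fun w => \sum_(i <- s) F i w) z.
Proof.
move=> hF; elim: s => [|a s IH].
  by under eq_fun do rewrite big_nil; exact: holo_cst.
have -> : (fun w => \sum_(i <- a :: s) F i w) =
          (fun w => F a w + \sum_(i <- s) F i w).
  by apply/funext => w; rewrite big_cons.
by have := holoD (hF a) IH.
Qed.

Lemma derivable_holo f z : derivable (f : R[i]^o -> R[i]^o) z 1 -> holo f z.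
Proof. by []. Qed.

Lemma ccont_normc f z : ccont f z -> forall e, 0 < e ->
  exists2 r : R, 0 < r &
    forall w, normc (w - z) < r -> `|normc (f w) - normc (f z)| < e.
Proof.
move=> cf e /cf[r r0 rf]; exists r => // w /rf; apply: le_lt_trans.
exact: dist_normc.
Qed.

End complex_kit.

Arguments holo_cst {R} a z.
Arguments holo_id {R} z.
(* Otherwise unification unfolds [holo] to the limit of a difference quotient. *)
#[global] Opaque holo.

(** * Goursat's theorem on a rectangle *)

Section goursat.
Context {R : realType}.
Implicit Types (x y a b c d e r : R).

(** Integrals along edges enter Goursat's argument only as differences of such primitives, so the
    mean value theorem replaces estimates of integrals. *)
Lemma antiderivative (f : R -> R) a b : a < b ->
  (forall x, a <= x <= b -> {for x, continuous f}) ->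
  exists F : R -> R, {within `[a, b], continuous F} /\
    forall x, x \in `]a, b[%R -> is_derive x 1 F (f x).
Proof.
move=> ab cf.
have intf : (@lebesgue_measure R).-integrable `[a, b] (EFin \o f).
  apply: continuous_compact_integrable; first exact: segment_compact.
  by apply: continuous_in_subspaceT => x; rewrite inE/= in_itv/= => /cf.
exists (fun x => parameterized_integral (@lebesgue_measure R) a x f); split.
  exact: parameterized_integral_continuous (ltW ab) intf.
move=> x; rewrite in_itv/= => /andP[ax xb].
have cfx : {for x, continuous f} by apply: cf; rewrite !ltW.
have [dF dFE] := continuous_FTC1_closed xb intf ax cfx.
by apply: (DeriveDef dF); rewrite -dFE derive1E.
Qed.

(** Mean value theorem for [F - G], to be used with the primitives on two opposite edges of a
    rectangle; [k] is the linear prediction for the difference of the integrands. *)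
Lemma MVT_diff_bound (F G f g : R -> R) a0 b0 a b (k e : R) :
  a0 <= a -> a < b -> b <= b0 ->
  {within `[a0, b0], continuous F} -> {within `[a0, b0], continuous G} ->
  (forall x, x \in `]a0, b0[%R -> is_derive x 1 F (f x)) ->
  (forall x, x \in `]a0, b0[%R -> is_derive x 1 G (g x)) ->
  (forall x, a <= x <= b -> `|f x - g x - k| <= e) ->
  `|(F b - F a) - (G b - G a) - k * (b - a)| <= e * (b - a).
Proof.
move=> a0a ab bb0 cF cG dF dG H.
have sub : `[a, b] `<=` `[a0, b0] by apply: subset_itv; rewrite bnd_simp.
have dFG x : x \in `]a, b[%R ->
    is_derive x 1 (fun t => F t - G t) (f x - g x).
  rewrite in_itv/= => /andP[ax xb].
  have xab0 : x \in `]a0, b0[%R.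
    by rewrite in_itv/= (le_lt_trans a0a ax) (lt_le_trans xb bb0).
  exact: (@is_deriveB _ _ _ F G x 1 _ _ (dF x xab0) (dG x xab0)).
have cFG : {within `[a, b], continuous (fun t => F t - G t)}.
  have cF' := continuous_subspaceW sub cF.
  have cG' := continuous_subspaceW sub cG.
  by move=> x; apply: cvgB; [exact: cF'|exact: cG'].
have [x xab E] := MVT ab dFG cFG.
have -> : F b - F a - (G b - G a) - k * (b - a) = (f x - g x - k) * (b - a).
  by rewrite mulrBl -E; ring.
rewrite normrM (gtr0_norm (_ : 0 < b - a)) ?subr_gt0// ler_pM2r ?subr_gt0//.
by apply: H; move: xab; rewrite in_itv/= => /andP[/ltW -> /ltW ->].
Qed.

(* [P dx + Q dy] is closed at [(x, y)]: [P] and [Q] are differentiable there and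
   [k] is the common value of [dP/dy] and [dQ/dx]. *)
Definition closed_pair_at (P Q : R -> R -> R) x y := exists p k q : R,
  forall e, 0 < e -> exists2 r, 0 < r & forall x' y',
    `|x' - x| < r -> `|y' - y| < r ->
    `|P x' y' - P x y - p * (x' - x) - k * (y' - y)| <=
       e * (`|x' - x| + `|y' - y|) /\
    `|Q x' y' - Q x y - k * (x' - x) - q * (y' - y)| <=
       e * (`|x' - x| + `|y' - y|).

Lemma linear_approx_continuous (f : R -> R) x (p : R) :
  (forall e, 0 < e -> exists2 r, 0 < r & forall x', `|x' - x| < r ->
     `|f x' - f x - p * (x' - x)| <= e * `|x' - x|) ->
  {for x, continuous f}.
Proof.
move=> H; apply/cvgrPdist_le => e e0; have [r r0 rf] := H 1 ltr01.
pose s := Num.min r (e / (1 + `|p|)).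
have p1 : 0 < 1 + `|p| by rewrite ltr_pwDl.
have s0 : 0 < s by rewrite lt_min r0 divr_gt0.
near=> x'.
have : `|x' - x| < s by near: x'; exact: cvgr_distC_lt.
rewrite lt_min => /andP[/rf h1 h2].
rewrite distrC; apply: le_trans (_ : (1 + `|p|) * `|x' - x| <= _); last first.
  by rewrite mulrC -ler_pdivlMr// ltW.
rewrite mulrDl -normrM -[f x' - f x](subrK (p * (x' - x))).
by rewrite (le_trans (ler_normD _ _))// lerD2r.
Unshelve. all: by end_near. Qed.

End goursat.

Lemma dist_le_width (R : realDomainType) (a b x y : R) :
  a <= x <= b -> a <= y <= b -> `|x - y| <= b - a.
Proof.
by move=> /andP[? ?] /andP[? ?]; rewrite ler_norml; apply/andP; split; lra.
Qed.

Section goursat_rectangle.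
Context {R : realType}.
Variables (P Q : R -> R -> R) (a0 b0 c0 d0 : R).
Hypotheses (ab0 : a0 < b0) (cd0 : c0 < d0).
Hypothesis PQ : forall x y, a0 <= x <= b0 -> c0 <= y <= d0 ->
  closed_pair_at P Q x y.
Variables X Y : R -> R -> R.
Hypothesis XP : forall y, c0 <= y <= d0 -> {within `[a0, b0], continuous X y} /\
  forall x, x \in `]a0, b0[%R -> is_derive x 1 (X y) (P x y).
Hypothesis YQ : forall x, a0 <= x <= b0 -> {within `[c0, d0], continuous Y x} /\
  forall y, y \in `]c0, d0[%R -> is_derive y 1 (Y x) (Q x y).

(* The integral of [P dx + Q dy] along the boundary of [a, b] x [c, d]. *)
Let J a b c d := (X c b - X c a) - (X d b - X d a) +
  ((Y b d - Y b c) - (Y a d - Y a c)).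

(** The affine part of the form at [(x, y)] is closed and contributes nothing; the remainder is
    small compared with the square of the half perimeter. *)
Let J_small x y : a0 <= x <= b0 -> c0 <= y <= d0 -> forall e, 0 < e ->
  exists2 r, 0 < r & forall a b c d, a0 <= a -> a <= x <= b -> b <= b0 ->
    c0 <= c -> c <= y <= d -> d <= d0 -> a < b -> c < d ->
    b - a < r -> d - c < r ->
    `|J a b c d| <= e * ((b - a) + (d - c)) ^+ 2.
Proof.
move=> xab ycd e e0; have [p [k [q H]]] := PQ xab ycd.
have [r r0 rPQ] := H _ (divr_gt0 e0 (@ltr0Sn R 1)).
exists r => // a b c d a0a /andP[ax xb] bb0 c0c /andP[cy yd] dd0 ab cd abr cdr.
have caba : c0 <= c <= d0 by rewrite c0c (le_trans _ dd0)// ltW.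
have dada : c0 <= d <= d0 by rewrite dd0 andbT (le_trans c0c)// ltW.
have aaba : a0 <= a <= b0 by rewrite a0a (le_trans _ bb0)// ltW.
have bbba : a0 <= b <= b0 by rewrite bb0 andbT (le_trans a0a)// ltW.
have [cXc dXc] := XP caba; have [cXd dXd] := XP dada.
have [cYa dYa] := YQ aaba; have [cYb dYb] := YQ bbba.
pose S := (b - a) + (d - c).
have tx t : a <= t <= b -> `|t - x| <= b - a.
  by move=> tab; apply: dist_le_width => //; rewrite ax.
have ty t : c <= t <= d -> `|t - y| <= d - c.
  by move=> tab; apply: dist_le_width => //; rewrite cy.
have cc : c <= c <= d by rewrite lexx ltW.
have dd : c <= d <= d by rewrite lexx ltW.
have aa : a <= a <= b by rewrite lexx ltW.
have bb : a <= b <= b by rewrite lexx ltW.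
have near_xy s t : a <= s <= b -> c <= t <= d ->
    `|P s t - P x y - p * (s - x) - k * (t - y)| <= e / 2 * S /\
    `|Q s t - Q x y - k * (s - x) - q * (t - y)| <= e / 2 * S.
  move=> /tx sab /ty tcd.
  have [h1 h2] := rPQ s t (le_lt_trans sab abr) (le_lt_trans tcd cdr).
  have h : e / 2 * (`|s - x| + `|t - y|) <= e / 2 * S.
    by rewrite ler_pM2l ?divr_gt0// lerD.
  by split; [exact: le_trans h1 h|exact: le_trans h2 h].
have halves u v z : z = v - u -> `|u| <= e / 2 * S -> `|v| <= e / 2 * S ->
    `|z| <= e * S.
  move=> -> hu hv; rewrite (splitr e) mulrDl.
  by rewrite (le_trans (ler_normB _ _))// lerD.
have hX : `|(X c b - X c a) - (X d b - X d a) - k * (c - d) * (b - a)|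
    <= e * S * (b - a).
  apply: (MVT_diff_bound a0a ab bb0 cXc cXd dXc dXd) => t tab.
  have [+ _] := near_xy t c tab cc; have [+ _] := near_xy t d tab dd.
  by move=> h1 h2; apply: halves h1 h2; ring.
have hY : `|(Y b d - Y b c) - (Y a d - Y a c) - k * (b - a) * (d - c)|
    <= e * S * (d - c).
  apply: (MVT_diff_bound c0c cd dd0 cYb cYa dYb dYa) => t tcd.
  have [_ +] := near_xy b t bb tcd; have [_ +] := near_xy a t aa tcd.
  by move=> h1 h2; apply: halves h1 h2; ring.
(* The two terms in [k] cancel: this is where [dP/dy = dQ/dx] is used. *)
have -> : J a b c d =
   ((X c b - X c a) - (X d b - X d a) - k * (c - d) * (b - a)) +
   ((Y b d - Y b c) - (Y a d - Y a c) - k * (b - a) * (d - c)).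
  by rewrite /J; ring.
apply: le_trans (ler_normD _ _) _; apply: le_trans (lerD hX hY) _.
by rewrite -mulrDr expr2 mulrA.
Qed.

Let J_split a m b c n d : J a b c d =
  J a m c n + J m b c n + J a m n d + J m b n d.
Proof. by rewrite /J; ring. Qed.

Let w := b0 - a0.
Let h := d0 - c0.
Let K := `|J a0 b0 c0 d0|.

(** A triple encodes the copy of the original rectangle scaled by [s] with lower left corner
    [(a, c)]; it is good if its boundary integral has not shrunk faster than its area. *)
Let good (p : R * R * R) := let: (a, c, s) := p in
  [/\ 0 < s, a0 <= a, a + w * s <= b0, c0 <= c & c + h * s <= d0] /\
  K * s ^+ 2 <= `|J a (a + w * s) c (c + h * s)|.

Let nested (p p' : R * R * R) := let: (a, c, s) := p in
  let: (a', c', s') := p' in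
  [/\ s' = s / 2, a <= a', a' + w * s' <= a + w * s, c <= c' &
      c' + h * s' <= c + h * s].

Let w0 : 0 < w. Proof. by rewrite subr_gt0. Qed.
Let h0 : 0 < h. Proof. by rewrite subr_gt0. Qed.

(** Pigeonhole on the four quarters: one of them carries at least a quarter of the boundary
    integral. *)
Let good_next p : good p -> exists p', good p' /\ nested p p'.
Proof.
move: p => [[a c] s] [[s0 a0a abb c0c cdd] Ks].
pose w' := w * (s / 2); pose h' := h * (s / 2).
have w'0 : 0 < w' by rewrite mulr_gt0// divr_gt0.
have h'0 : 0 < h' by rewrite mulr_gt0// divr_gt0.
have wE : w * s = w' + w' by rewrite /w'; field.
have hE : h * s = h' + h' by rewrite /h'; field.
rewrite wE in abb Ks; rewrite hE in cdd Ks.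
pose L := K * (s / 2) ^+ 2.
have LE : K * s ^+ 2 = L + L + L + L by rewrite /L; field.
rewrite LE in Ks.
suff : exists2 p', (p' = (a, c) \/ p' = (a + w', c)) \/
    (p' = (a, c + h') \/ p' = (a + w', c + h')) &
    L <= `|J p'.1 (p'.1 + w') p'.2 (p'.2 + h')|.
  move=> [[a' c'] /= cas LJ]; exists (a', c', s / 2); rewrite /good /nested.
  rewrite -/w' -/h' wE hE divr_gt0//.
  by move: cas => [] [] [-> ->] in LJ *; (split; [split; [split|]|split]) => //; lra.
rewrite (J_split a (a + w') _ c (c + h')) in Ks.
have tri (x y z t : R) : `|x + y + z + t| <= `|x| + `|y| + `|z| + `|t|.
  by rewrite !(le_trans (ler_normD _ _))// !lerD2r !(le_trans (ler_normD _ _))//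
    lerD2r ler_normD.
move: (le_trans Ks (tri _ _ _ _)); rewrite !addrA.
have [k1|k1] := leP L `|J a (a + w') c (c + h')|.
  by exists (a, c) => //; left; left.
have [k2|k2] := leP L `|J (a + w') (a + w' + w') c (c + h')|.
  by exists (a + w', c) => //; left; right.
have [k3|k3] := leP L `|J a (a + w') (c + h') (c + h' + h')|.
  by exists (a, c + h') => //; right; left.
have [k4|k4] := leP L
    `|J (a + w') (a + w' + w') (c + h') (c + h' + h')|.
  by exists (a + w', c + h') => //; right; right.
by move=> ?; exfalso; lra.
Qed.

Lemma boundary_integral_eq0 : J a0 b0 c0 d0 = 0.
Proof.
have good0 : good (a0, c0, 1).
  rewrite /good !mulr1 expr1n mulr1 /w /h !subrKC !lexx; split => //.
(* Dependent choice needs a total step, so a triple that is not good is left unchanged. *)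
have step p : {p' | good p -> good p' /\ nested p p'}.
  apply: cid; have [/good_next[p' hp']|ngp] := pselect (good p).
    by exists p'.
  by exists p.
have [f [f0 fS]] := dependent_choice step (a0, c0, 1).
have gf n : good (f n).
  by elim: n => [|n IH]; [rewrite f0|have [] := fS n IH].
have nf n : nested (f n) (f n.+1) by have [] := fS n (gf n).
pose a n := (f n).1.1; pose c n := (f n).1.2; pose s n := (f n).2.
have fE n : f n = (a n, c n, s n) by rewrite /a /c /s; case: (f n) => [[]].
have sE n : s n = 2^-1 ^+ n.
  elim: n => [|n IH]; first by rewrite expr0 /s f0.
  by have := nf n; rewrite !fE => -[-> _ _ _ _]; rewrite IH exprSr.
have mon n m : [/\ a n <= a (n + m)%N, a (n + m)%N + w * s (n + m)%N <= a n + w * s n,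
    c n <= c (n + m)%N & c (n + m)%N + h * s (n + m)%N <= c n + h * s n].
  elim: m => [|m [h1 h2 h3 h4]]; first by rewrite addn0.
  have := nf (n + m)%N; rewrite !fE => -[_ k1 k2 k3 k4].
  rewrite addnS; split; [exact: le_trans h1 k1|exact: le_trans k2 h2|
    exact: le_trans h3 k3|exact: le_trans k4 h4].
have s_gt0 n : 0 < s n by rewrite sE exprn_gt0.
have aub n m : a n <= a m + w * s m.
  have [nm|/ltnW mn] := leqP n m.
    have [] := mon n (m - n)%N; rewrite subnKC// => h1 _ _ _.
    by rewrite (le_trans h1)// lerDl mulr_ge0// ltW.
  have [] := mon m (n - m)%N; rewrite subnKC// => _ h2 _ _.
  by rewrite (le_trans _ h2)// lerDl mulr_ge0// ltW.
have cub n m : c n <= c m + h * s m.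
  have [nm|/ltnW mn] := leqP n m.
    have [] := mon n (m - n)%N; rewrite subnKC// => _ _ h1 _.
    by rewrite (le_trans h1)// lerDl mulr_ge0// ltW.
  have [] := mon m (n - m)%N; rewrite subnKC// => _ _ _ h2.
  by rewrite (le_trans _ h2)// lerDl mulr_ge0// ltW.
pose x := sup (range a); pose y := sup (range c).
have xn n : a n <= x <= a n + w * s n.
  apply/andP; split.
    by apply: ub_le_sup; [exists (a 0%N + w * s 0%N) => _ [m _ <-]|exists n].
  by apply: ge_sup; [exists (a 0%N), 0%N|move=> _ [m _ <-]].
have yn n : c n <= y <= c n + h * s n.
  apply/andP; split.
    by apply: ub_le_sup; [exists (c 0%N + h * s 0%N) => _ [m _ <-]|exists n].
  by apply: ge_sup; [exists (c 0%N), 0%N|move=> _ [m _ <-]].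
have a00 : a 0%N = a0 by rewrite /a f0.
have c00 : c 0%N = c0 by rewrite /c f0.
have s00 : s 0%N = 1 by rewrite /s f0.
have xab : a0 <= x <= b0 by have := xn 0%N; rewrite a00 s00 mulr1 subrKC.
have ycd : c0 <= y <= d0 by have := yn 0%N; rewrite c00 s00 mulr1 subrKC.
apply/eqP; rewrite -normr_le0; apply/ler_addgt0Pl => e e0; rewrite addr0.
have wh0 : 0 < w + h by rewrite addr_gt0.
(* The [n]-th half perimeter is [(w + h) * s n]; with this tolerance [J_small] bounds the integral
   by [e * s n ^+ 2], against the lower bound [K * s n ^+ 2]. *)
have e'0 : 0 < e / (w + h) ^+ 2 by rewrite divr_gt0// exprn_gt0.
have [r r0 Hr] := J_small xab ycd e'0.
pose n := Num.bound ((w + h) / r).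
have nr : (w + h) * s n < r.
  have := upper_nthrootP (leqnn n); rewrite ltr_pdivrMr// mulrC => hn.
  by rewrite sE exprVn ltr_pdivrMr ?exprn_gt0.
have := gf n; rewrite fE => -[[sn0 k1 k2 k3 k4] k5].
have ws0 : 0 < w * s n by rewrite mulr_gt0.
have hs0 : 0 < h * s n by rewrite mulr_gt0.
have aE u v : u + v - u = v :> R by rewrite addrAC subrr add0r.
have := Hr _ _ _ _ k1 (xn n) k2 k3 (yn n) k4; rewrite !ltrDl ws0 hs0 !aE.
move: nr; rewrite mulrDl => nr.
have -> : w * s n < r by rewrite (le_lt_trans _ nr)// lerDl ltW.
have -> : h * s n < r by rewrite (le_lt_trans _ nr)// lerDr ltW.
move=> /(_ isT isT isT isT); rewrite -mulrDl exprMn mulrA divfK; last first.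
  by rewrite expf_neq0// gt_eqF.
by move=> /(le_trans k5); rewrite ler_pM2r// exprn_gt0.
Qed.

End goursat_rectangle.

Lemma closed_pair_continuous1 (R : realType) (P Q : R -> R -> R) x y :
  closed_pair_at P Q x y -> {for x, continuous (fun t => P t y)}.
Proof.
move=> [p [k [q H]]]; apply: (@linear_approx_continuous _ _ _ p) => e /H[r r0 rf].
exists r => // x' xr; have [] := rf x' y xr; first by rewrite subrr normr0.
by rewrite subrr normr0 mulr0 subr0 addr0.
Qed.

Lemma closed_pair_continuous2 (R : realType) (P Q : R -> R -> R) x y :
  closed_pair_at P Q x y -> {for y, continuous (Q x)}.
Proof.
move=> [p [k [q H]]]; apply: (@linear_approx_continuous _ _ _ q) => e /H[r r0 rf].
exists r => // y' yr; have xx : `|x - x| < r by rewrite subrr normr0.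
by have [_] := rf x y' xx yr; rewrite subrr normr0 mulr0 subr0 add0r.
Qed.

(** Periodicity cancels the horizontal edges, so [Q b0 - Q a0] has integral 0 over [[c0, d0]] and
    vanishes somewhere. One such height is all that the maximum principle needs. *)
Lemma closed_pair_periodic (R : realType) (P Q : R -> R -> R) a0 b0 c0 d0 :
  a0 < b0 -> c0 < d0 ->
  (forall x y, a0 <= x <= b0 -> c0 <= y <= d0 -> closed_pair_at P Q x y) ->
  (forall x, P x c0 = P x d0) ->
  exists y, Q b0 y = Q a0 y.
Proof.
move=> ab cd PQ per.
have exX y : exists F : R -> R, c0 <= y <= d0 ->
    {within `[a0, b0], continuous F} /\
    forall x, x \in `]a0, b0[%R -> is_derive x 1 F (P x y).
  have [ycd|] := boolP (c0 <= y <= d0); last by exists idfun.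
  have cP x : a0 <= x <= b0 -> {for x, continuous (fun t => P t y)}.
    by move=> xab; exact: closed_pair_continuous1 (PQ _ _ xab ycd).
  by have [F HF] := antiderivative ab cP; exists F.
have exY x : exists F : R -> R, a0 <= x <= b0 ->
    {within `[c0, d0], continuous F} /\
    forall y, y \in `]c0, d0[%R -> is_derive y 1 F (Q x y).
  have [xab|] := boolP (a0 <= x <= b0); last by exists idfun.
  have cQ y : c0 <= y <= d0 -> {for y, continuous (Q x)}.
    by move=> ycd; exact: closed_pair_continuous2 (PQ _ _ xab ycd).
  by have [F HF] := antiderivative cd cQ; exists F.
have [X XP] := choice exX; have [Y YQ] := choice exY.
have := boundary_integral_eq0 ab cd PQ XP YQ.
have ccd : c0 <= c0 <= d0 by rewrite lexx ltW.
have dcd : c0 <= d0 <= d0 by rewrite lexx ltW.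
have aab : a0 <= a0 <= b0 by rewrite lexx ltW.
have bab : a0 <= b0 <= b0 by rewrite lexx ltW.
have [cX1 dX1] := XP _ ccd; have [cX2 dX2] := XP _ dcd.
have [cY1 dY1] := YQ _ aab; have [cY2 dY2] := YQ _ bab.
have := MVT_diff_bound (k := 0) (e := 0) (lexx a0) ab (lexx b0) cX1 cX2 dX1 dX2.
rewrite !mul0r subr0 => XE.
have {XE} -> : X c0 b0 - X c0 a0 - (X d0 b0 - X d0 a0) = 0.
  apply/eqP; rewrite -normr_le0; apply: XE => x _.
  by rewrite per subrr subr0 normr0.
rewrite add0r => YE.
have dYY y : y \in `]c0, d0[%R ->
    is_derive y 1 (fun t => Y b0 t - Y a0 t) (Q b0 y - Q a0 y).
  move=> yy; exact: (@is_deriveB _ _ _ (Y b0) (Y a0) y 1 _ _ (dY2 _ yy) (dY1 _ yy)).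
have cYY : {within `[c0, d0], continuous (fun t => Y b0 t - Y a0 t)}.
  by move=> y; apply: cvgB; [exact: cY2|exact: cY1].
have [y ycd E] := MVT cd dYY cYY; exists y.
move: E; rewrite (_ : _ - _ - _ = 0); last by rewrite -YE; ring.
by move/esym/eqP; rewrite mulf_eq0 !subr_eq0 (gt_eqF cd) orbF => /eqP.
Qed.

(** * The complex exponential and the maximum principle *)

Definition expc {R : realType} (z : R[i]) : R[i] :=
  ((expR (Re z) * cos (Im z)) +i* (expR (Re z) * sin (Im z)))%C.

Section complex_exponential.
Context {R : realType}.
Implicit Types (z w : R[i]) (x y e : R).

Lemma expcD z w : expc (z + w) = expc z * expc w.
Proof.
apply/eqP; rewrite /expc eq_complex /= !ReImE /= expRD cosD sinD.
by apply/andP; split; apply/eqP; ring.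
Qed.

Lemma normc_expc z : normc (expc z) = expR (Re z).
Proof.
rewrite /expc /= !exprMn -mulrDr cos2Dsin2 mulr1 sqrtr_sqr ger0_norm//.
Qed.

Lemma expc_neq0 z : expc z != 0.
Proof. by rewrite -normc_eq0 normc_expc gt_eqF// expR_gt0. Qed.

Lemma expc0 : expc (0 : R[i]) = 1.
Proof. by rewrite /expc /= expR0 cos0 sin0 !mul1r. Qed.

Lemma derivative_at0 (f : R -> R) (d : R) : is_derive (0 : R) 1 f d ->
  forall e, 0 < e -> exists2 r, 0 < r & forall x, `|x| < r ->
    `|f x - f 0 - d * x| <= e * `|x|.
Proof.
move=> [df dE] e e0; move: df => /cvg_ex[l] dl.
have ld : l = d by rewrite -dE; apply/esym/cvg_lim.
have := dl; rewrite ld => /cvgrPdist_le/(_ _ e0).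
rewrite near_withinE => /nbhs_ballP[r /= r0 H]; exists r => // x xr.
have [->|x0] := eqVneq x 0; first by rewrite subrr mulr0 subrr normr0 mulr0.
have := H x; rewrite /ball/= sub0r normrN => /(_ xr x0).
rewrite /GRing.scale/= addr0 mulr1 => h.
rewrite -ler_pdivrMr ?normr_gt0// -normf_div -normrN; apply: le_trans h.
by rewrite le_eqVlt; apply/orP; left; apply/eqP; congr Num.norm; field.
Qed.

Lemma expc_taylor1 e : 0 < e -> exists2 r : R, 0 < r & forall z, normc z < r ->
  normc (expc z - 1 - z) <= e * normc z.
Proof.
(* The factor 9 is [1 + 3 + 3 + 2], the sum of the coefficients of [d * n] in the four error terms
   below. *)
move=> e0; have [d [d0 d1 d9]] : exists d : R, [/\ 0 < d, d <= 1 & 9 * d <= e].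
  exists (Num.min 1 (e / 9)); rewrite lt_min ltr01 divr_gt0//; split => //.
    by rewrite ge_min lexx.
  by rewrite mulrC -ler_pdivlMr// ge_min lexx orbT.
have [r1 r10 H1] := derivative_at0 (is_derive_expR 0) d0.
have [r2 r20 H2] := derivative_at0 (is_derive_sin 0) d0.
have [r3 r30 H3] := derivative_at0 (is_derive_cos 0) d0.
exists (Num.min (Num.min r1 r2) (Num.min r3 d)).
  by rewrite !lt_min r10 r20 r30 d0.
move=> z; rewrite !lt_min => /andP[/andP[zr1 zr2] /andP[zr3 zd]].
have hx := Re_le_normc z; have hy := Im_le_normc z.
have := H1 _ (le_lt_trans hx zr1); rewrite expR0 mul1r => {}H1.
have := H2 _ (le_lt_trans hy zr2); rewrite sin0 cos0 mul1r subr0 => {}H2.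
have := H3 _ (le_lt_trans hy zr3); rewrite cos0 sin0 oppr0 mul0r subr0 => {}H3.
set n := normc z in zr1 zr2 zr3 zd hx hy *; have n0 : 0 <= n by exact: normc_ge0.
move: H1 H2 H3 hx hy; rewrite /expc.
set x := Re z; set y := Im z => H1 H2 H3 hx hy.
have {}H1 : `|expR x - 1 - x| <= d * n by rewrite (le_trans H1)// ler_pM2l.
have {}H2 : `|sin y - y| <= d * n by rewrite (le_trans H2)// ler_pM2l.
have {}H3 : `|cos y - 1| <= d * n by rewrite (le_trans H3)// ler_pM2l.
have dn : d * n <= d by rewrite ler_piMr// ?ltW// (lt_le_trans zd).
have ex1 : `|expR x - 1| <= 2 * d.
  rewrite -[expR x - 1](subrK x) (le_trans (ler_normD _ _))//.
  by rewrite mulr_natl mulr2n lerD// ?(le_trans H1)// (le_trans hx)// ltW.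
have ex3 : `|expR x| <= 3.
  rewrite -[expR x](subrK 1) (le_trans (ler_normD _ _))// normr1.
  have : 2 * d <= 2 by rewrite ler_piMr.
  by move=> ?; lra.
apply: le_trans (normc_le_ReIm _) _; rewrite !ReImE /= subr0 -/x -/y.
have -> : expR x * cos y - 1 - x = (expR x - 1 - x) + expR x * (cos y - 1).
  by ring.
have -> : expR x * sin y - y = expR x * (sin y - y) + (expR x - 1) * y by ring.
have k1 : `|expR x * (cos y - 1)| <= 3 * (d * n) by rewrite normrM ler_pM.
have k2 : `|expR x * (sin y - y)| <= 3 * (d * n) by rewrite normrM ler_pM.
have k3 : `|(expR x - 1) * y| <= 2 * (d * n).
  by rewrite normrM mulrA ler_pM.
apply: le_trans (lerD (le_trans (ler_normD _ _) (lerD H1 k1))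
  (le_trans (ler_normD _ _) (lerD k2 k3))) _.
have -> : d * n + 3 * (d * n) + (3 * (d * n) + 2 * (d * n)) = 9 * d * n by ring.
by apply: ler_wpM2r.
Qed.

Lemma holo_expc z : holo expc z.
Proof.
apply/holoP; exists (expc z) => e e0.
have n0 : 0 < normc (expc z) by rewrite normc_gt0 expc_neq0.
have [r r0 H] := expc_taylor1 (divr_gt0 e0 n0).
exists r => // w /H Hw.
have -> : expc w - expc z - expc z * (w - z) =
    expc z * (expc (w - z) - 1 - (w - z)).
  by rewrite !mulrBr mulr1 -expcD subrKC.
rewrite normcM; apply: le_trans (ler_wpM2l (normc_ge0 _) Hw) _.
by rewrite mulrA [X in X * _]mulrC divfK// gt_eqF.
Qed.

End complex_exponential.

Section maximum_principle.
Context {R : realType}.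
Implicit Types (z w : R[i]) (x y e : R).

(** The form is the imaginary part of [h dz], and its closedness is one of the Cauchy-Riemann
    equations. *)
Lemma holo_closed_pair (h : R[i] -> R[i]) x y : holo h (x +i* y)%C ->
  closed_pair_at (fun x y => Im (h (x +i* y)%C)) (fun x y => Re (h (x +i* y)%C))
    x y.
Proof.
move=> /holoP[d H]; exists (Im d), (Re d), (- Im d) => e e0.
have [r r0 Hr] := H _ e0; exists (r / 2); first by rewrite divr_gt0.
move=> x' y' xr yr.
have zE : (x' +i* y')%C - (x +i* y)%C = ((x' - x) +i* (y' - y))%C by [].
have nle : normc ((x' +i* y')%C - (x +i* y)%C) <= `|x' - x| + `|y' - y|.
  exact: normc_le_ReIm.
have /Hr Hz : normc ((x' +i* y')%C - (x +i* y)%C) < r.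
  by rewrite (le_lt_trans nle)// (splitr r) ltrD.
have {}Hz := le_trans Hz (ler_wpM2l (ltW e0) nle).
split.
- apply: le_trans Hz; apply: le_trans (Im_le_normc _).
  by rewrite zE !ReImE /= le_eqVlt; apply/orP; left; apply/eqP; congr Num.norm; ring.
- apply: le_trans Hz; apply: le_trans (Re_le_normc _).
  by rewrite zE !ReImE /= le_eqVlt; apply/orP; left; apply/eqP; congr Num.norm; ring.
Qed.

Lemma expc_2pi x : expc (x +i* 0)%C = expc (x +i* (pi *+ 2))%C.
Proof. by rewrite /expc /= cos0 sin0 cos2pi sin2pi. Qed.

(* Integrating [Psi (z0 + exp xi)] around the rectangle [a, b] x [0, 2 pi] shows
   that the mean of [Re Psi] over small circles about [z0] does not depend on
   the radius. *)
Lemma holo_no_strict_Re_max (Psi : R[i] -> R[i]) z0 (delta e : R) :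
  0 < delta -> 0 < e ->
  (forall w, normc (w - z0) < delta -> holo Psi w) ->
  (forall w, normc (w - z0) < delta ->
     Re (Psi w) <= Re (Psi z0) - e * normc (w - z0) ^+ 2) -> False.
Proof.
move=> delta0 e0 hPsi mPsi.
pose b := ln (delta / 2).
have d20 : 0 < delta / 2 by rewrite divr_gt0.
have expb : expR b = delta / 2 by rewrite /b lnK.
pose h z := Psi (z0 + expc z).
(* This is the drop of [Re Psi] below [Re (Psi z0)] on the circle of radius [delta / 2]. The inner
   radius [expR a] is taken so small that [Re Psi] drops by less there, yet the two values agree at
   some common angle. *)
have eta0 : 0 < e * (delta / 2) ^+ 2 by rewrite mulr_gt0// exprn_gt0.
have z0d : normc (z0 - z0) < delta by rewrite subrr normc0.
have [r r0 Hr] := holo_ccont (hPsi _ z0d) eta0.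
pose a := Num.min (b - 1) (ln (r / 2)).
have r20 : 0 < r / 2 by rewrite divr_gt0.
have ab : a < b by rewrite gt_min gtrBl ltr01.
have expa : expR a < r.
  apply: (@le_lt_trans _ _ (r / 2)); last by rewrite gtr_pMr// invf_lt1// ltr1n.
  by rewrite -[leRHS]lnK// ler_expR ge_min lexx orbT.
have hh x y : a <= x <= b -> holo h (x +i* y)%C.
  move=> /andP[_ xb]; apply: (holo_comp (f := fun z => z0 + expc z)).
    by apply: holoD; [exact: holo_cst|exact: holo_expc].
  apply: hPsi; rewrite addrAC subrr add0r normc_expc /=.
  rewrite (@le_lt_trans _ _ (delta / 2))//; first by rewrite -expb ler_expR.
  by rewrite gtr_pMr// invf_lt1// ltr1n.
have pi20 : 0 < pi *+ 2 :> R by rewrite mulrn_wgt0// pi_gt0.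
have [|x|y] := @closed_pair_periodic R
    (fun x y => Im (h (x +i* y)%C)) (fun x y => Re (h (x +i* y)%C)) a b 0 (pi *+ 2) ab pi20.
- by move=> x y xab _; exact/holo_closed_pair/hh.
- by rewrite /h expc_2pi.
rewrite /h => E.
have nb : normc (z0 + expc (b +i* y)%C - z0) = delta / 2.
  by rewrite addrAC subrr add0r normc_expc /= expb.
have na : normc (z0 + expc (a +i* y)%C - z0) < r.
  by rewrite addrAC subrr add0r normc_expc.
have := mPsi (z0 + expc (b +i* y)%C); rewrite nb E.
rewrite gtr_pMr// invf_lt1// ltr1n => /(_ isT) m1.
have := le_lt_trans (Re_le_normc _) (Hr _ na).
by rewrite ReD ReN ltr_norml => /andP[m2 _]; lra.
Qed.

End maximum_principle.

(** Compactness is taken in [R * R], where products of segments are compact and the extreme value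
    theorem applies to real functions. *)
Definition ccompact {R : realType} (K : set R[i]) : Prop :=
  compact [set p : R * R | K (p.1 +i* p.2)%C].

Section maximum_modulus.
Context {R : realType}.
Implicit Types (z w : R[i]) (x y e : R) (K : set R[i]).

Lemma complexK z : (Re z +i* Im z)%C = z.
Proof. by case: z. Qed.

Lemma ccont_continuous_normc (f : R[i] -> R[i]) (p : R * R) :
  ccont f (p.1 +i* p.2)%C ->
  {for p, continuous (fun q : R * R => normc (f (q.1 +i* q.2)%C))}.
Proof.
move=> cf; apply/cvgrPdist_lt => e e0.
have [r r0 Hr] := cf _ e0.
have r20 : 0 < r / 2 by rewrite divr_gt0.
apply: filterS (nbhsx_ballx p _ r20) => q /= [h1 h2]; rewrite distrC; apply: le_lt_trans (dist_normc _ _) _.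
apply: Hr; apply: le_lt_trans (normc_le_ReIm _) _; rewrite !ReImE /=.
by rewrite (splitr r) ltrD// distrC.
Qed.

Lemma ccompact_max (K : set R[i]) (v : R[i] -> R) : ccompact K -> K !=set0 ->
  (forall z, K z ->
    {for (Re z, Im z), continuous (fun q : R * R => v (q.1 +i* q.2)%C)}) ->
  exists2 z0, K z0 & forall z, K z -> v z <= v z0.
Proof.
move=> cK [k Kk] cv.
have [||[a b]] := @compact_EVT_max _ R (fun q : R * R => v (q.1 +i* q.2)%C) _ _ cK.
- by exists (Re k, Im k); rewrite /= complexK.
- by apply: continuous_in_subspaceT => -[a b]; rewrite inE /= => /cv.
rewrite inE /= => Kab H; exists (a +i* b)%C => // -[c d] Kcd.
by apply: (H (c, d)); rewrite inE.
Qed.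

Lemma sqr_normc_continuous (p : R * R) :
  {for p, continuous (fun q : R * R => normc (q.1 +i* q.2)%C ^+ 2)}.
Proof.
have -> : (fun q : R * R => normc (q.1 +i* q.2)%C ^+ 2) =
  (fun q => q.1 * q.1 + q.2 * q.2).
  by apply/funext => q; rewrite sqr_normcE /= !expr2.
by apply: cvgD; apply: cvgM; (exact: cvg_fst || exact: cvg_snd).
Qed.

Lemma ccompact_bounded (K : set R[i]) : ccompact K ->
  exists2 B : R, 0 < B & forall z, K z -> normc z <= B.
Proof.
move=> cK; have [K0|/set0P K0] := eqVneq K set0.
  by exists 1 => // z; rewrite K0.
have [|z0 _ H] := ccompact_max (v := fun z => normc z ^+ 2) cK K0.
  by move=> z _; exact: sqr_normc_continuous.
exists (normc z0 + 1); first by rewrite ltr_wpDl// normc_ge0.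
move=> z /H; rewrite ler_pXn2r// ?nnegrE ?normc_ge0// => /le_trans; apply.
by rewrite lerDl.
Qed.

(* Allowing [Phi] to be non-differentiable at its zeros makes the principle
   applicable to quotients with removable singularities. *)
Lemma maximum_modulus (K : set R[i]) (Phi : R[i] -> R[i]) (M : R) :
  ccompact K -> 0 <= M ->
  (forall z, K z -> ccont Phi z) ->
  (forall z, K z -> Phi z != 0 -> holo Phi z) ->
  (forall z, K z -> normc (Phi z) <= M \/
     exists2 d, 0 < d & forall w, normc (w - z) < d -> K w) ->
  forall z, K z -> normc (Phi z) <= M.
Proof.
move=> cK M0 cPhi hPhi bPhi z Kz.
have [B B0 KB] := ccompact_bounded cK.
apply/ler_addgt0Pr => e' e'0.
(* The perturbation [e * normc w ^+ 2] stays below [e'] on [K]; it turns a maximum point into a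
   strict one for a suitable analytic function. *)
pose e := e' / B ^+ 2; have e0 : 0 < e by rewrite divr_gt0// exprn_gt0.
pose v w := normc (Phi w) + e * normc w ^+ 2.
have [||z0 Kz0 maxv] := @ccompact_max K v cK.
- by exists z.
- move=> w Kw; apply: cvgD.
    by apply: ccont_continuous_normc; rewrite /= complexK; exact: cPhi.
  by apply: cvgM; [exact: cvg_cst|exact: sqr_normc_continuous].
have [small|large] := leP (normc (Phi z0)) M.
  apply: (@le_trans _ _ (v z)); first by rewrite lerDl mulr_ge0 ?sqr_ge0// ltW.
  apply: le_trans (maxv _ Kz) _; rewrite lerD// /e mulrAC ler_pdivrMr ?exprn_gt0//.
  by rewrite ler_pM2l// ler_pXn2r ?nnegrE ?normc_ge0 ?KB// ltW.
have [|[d d0 Kd]] := bPhi _ Kz0; first by rewrite leNgt large.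
have P0 : 0 < normc (Phi z0) by exact: le_lt_trans large.
have [r r0 Hr] := ccont_normc (cPhi _ Kz0) P0.
(* A unimodular factor that rotates [Phi z0] onto the positive real axis. *)
pose u := (Phi z0)^*%C / (normc (Phi z0))%:C%C.
have nu : normc u = 1.
  rewrite /u normcM normcV normc_real ger0_norm ?normc_ge0//.
  have -> : normc (Phi z0)^*%C = normc (Phi z0).
    by case: (Phi z0) => a b /=; rewrite sqrrN.
  by rewrite divff// gt_eqF.
have Phiu : Re (Phi z0 * u) = normc (Phi z0).
  have -> : Phi z0 * u = (normc (Phi z0))%:C%C; last by [].
  rewrite /u mulrA; apply: (mulIf (x := (normc (Phi z0))%:C%C)).
    by rewrite -normc_eq0 normc_real normr_eq0 gt_eqF.
  rewrite divfK; last by rewrite -normc_eq0 normc_real normr_eq0 gt_eqF.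
  rewrite -rmorphM -expr2 sqr_normcE; case: (Phi z0) => a b.
  apply/eqP; rewrite eq_complex /=.
  by apply/andP; split; apply/eqP; ring.
(* Since [|w|^2 = |w - z0|^2 + 2 Re (conj z0 * w) - |z0|^2], the linear term is the analytic part of
   the perturbation and leaves the strict drop [- e |w - z0|^2]. *)
pose Psi w := Phi w * u + ((2 * e)%:C%C * z0^*%C) * w.
exfalso; apply: (@holo_no_strict_Re_max R Psi z0 (Num.min d r) e) => //.
- by rewrite lt_min d0.
- move=> w; rewrite lt_min => /andP[wd wr]; apply: holoD; last first.
    by apply: holoM; [exact: holo_cst|exact: holo_id].
  apply: holoM; last exact: holo_cst.
  apply: hPhi; first exact: Kd.
  apply/negP => /eqP Pw; have := Hr _ wr.
  by rewrite Pw normc0 sub0r normrN ger0_norm ?normc_ge0// ltxx.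
- move=> w; rewrite lt_min => /andP[wd wr].
  have := maxv _ (Kd _ wd); rewrite /v => H1.
  have H2 : Re (Phi w * u) <= normc (Phi w).
    rewrite -[leRHS]mulr1 -nu -normcM.
    by apply: le_trans (Re_le_normc _); exact: ler_norm.
  rewrite /Psi !ReD Phiu.
  have k3 : Re ((2 * e)%:C%C * z0^*%C * w) =
     e * (normc w ^+ 2 + normc z0 ^+ 2 - normc (w - z0) ^+ 2).
    rewrite !sqr_normcE !ReImE; case: (z0) => a b; case: (w) => x y /=.
    ring.
  have k4 : Re ((2 * e)%:C%C * z0^*%C * z0) = e * (normc z0 ^+ 2) *+ 2.
    by rewrite !sqr_normcE !ReImE; case: (z0) => a b /=; ring.
  rewrite k3 k4 mulrBr mulrDr mulr2n.
  set A := e * normc w ^+ 2 in H1 *; set C := e * normc z0 ^+ 2 in H1 *.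
  set D := e * normc (w - z0) ^+ 2; lra.
Qed.

End maximum_modulus.

(** * Maximum principle and propagation of zeros on discs *)

Section discs.
Context {R : realType}.
Implicit Types (z w a : R[i]) (x y e r : R).

Lemma ccompact_disc a r : ccompact [set z | normc (z - a) <= r].
Proof.
pose B := `[Re a - r, Re a + r]%classic `*` `[Im a - r, Im a + r]%classic.
have cB : compact B by apply: compact_setX; exact: segment_compact.
apply: (subclosed_compact _ cB).
  have -> : [set p : R * R | normc ((p.1 +i* p.2)%C - a) <= r] =
      (fun p : R * R => normc ((p.1 +i* p.2)%C - a)) @^-1` [set x | x <= r].
    by [].
  apply: closed_comp; last exact: closed_le.
  move=> p _; apply: (@ccont_continuous_normc R (fun z => z - a)).
  by apply: holo_ccont; apply: holoB; [exact: holo_id|exact: holo_cst].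
move=> [x y] /= xy; have := le_trans (Re_le_normc _) xy.
have := le_trans (Im_le_normc _) xy; rewrite !ReImE /=.
rewrite !ler_norml => /andP[h1 h2] /andP[h3 h4].
by split; rewrite /= in_itv /=; apply/andP; split; lra.
Qed.

Lemma disc_nbhs a r z : normc (z - a) < r ->
  exists2 d, 0 < d & forall w, normc (w - z) < d -> normc (w - a) < r.
Proof.
move=> zr; exists (r - normc (z - a)); first by rewrite subr_gt0.
move=> w; rewrite ltrBrDr; apply: le_lt_trans.
by rewrite -(subrKA z) le_normcD.
Qed.

Lemma maximum_modulus_disc (Phi : R[i] -> R[i]) a r (M : R) : 0 <= M ->
  (forall z, normc (z - a) <= r -> ccont Phi z) ->
  (forall z, normc (z - a) <= r -> Phi z != 0 -> holo Phi z) ->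
  (forall z, normc (z - a) = r -> normc (Phi z) <= M) ->
  forall z, normc (z - a) <= r -> normc (Phi z) <= M.
Proof.
move=> M0 cPhi hPhi bPhi; apply: maximum_modulus => //.
  exact: ccompact_disc.
move=> z /=; rewrite le_eqVlt => /predU1P[/bPhi|/disc_nbhs[d d0 H]]; first by left.
by right; exists d => // w /H /ltW.
Qed.

(** The power trick: applying an estimate to [n]-th powers removes a constant [M] that does not
    depend on [n]. *)
Lemma ge1_geometric (x M t : R) : 0 < x -> 0 <= t ->
  (forall n, x <= M * t ^+ n) -> 1 <= t.
Proof.
move=> x0 t0 H; rewrite leNgt; apply/negP => t1.
have : geometric M t @ \oo --> 0 by apply: cvg_geometric; rewrite ger0_norm.
move=> /cvgrPdist_lt/(_ _ x0)[n _ /(_ n (leqnn n))].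
rewrite /= sub0r normrN => /(le_lt_trans (ler_norm _)).
by rewrite ltNge H.
Qed.

Lemma holo_bounded_disc (f : R[i] -> R[i]) a r :
  (forall z, normc (z - a) <= r -> ccont f z) ->
  exists2 M, 0 <= M & forall z, normc (z - a) <= r -> normc (f z) <= M.
Proof.
move=> cf; pose K := [set z | normc (z - a) <= r].
have [K0|/set0P K0] := eqVneq K set0.
  by exists 0 => // z Kz; have : K z by []; rewrite K0.
have [|z0 _ H] := ccompact_max (v := fun z => normc (f z)) (@ccompact_disc a r) K0.
  by move=> z Kz; apply: ccont_continuous_normc; rewrite /= complexK; exact: cf.
by exists (normc (f z0)); rewrite ?normc_ge0.
Qed.

Lemma ccont_locally_eq0 (f : R[i] -> R[i]) z r : 0 < r ->
  (forall w, normc (w - z) < r -> f w = 0) -> ccont f z.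
Proof.
move=> r0 H e e0; exists r => // w wr.
by rewrite H// H ?subrr normc0.
Qed.

(* Apply the maximum principle to [g z * (r / (z - a)) ^ n]. *)
Lemma holo_disc_vanish (g : R[i] -> R[i]) a (r d : R) : 0 < d ->
  (forall w, normc (w - a) < r -> holo g w) ->
  (forall w, normc (w - a) < d -> g w = 0) ->
  forall w, normc (w - a) < r -> g w = 0.
Proof.
move=> d0 hg g0 w wr; apply/eqP; rewrite -normc_eq0; apply/negP => /negP gw0.
have {gw0}gw0 : 0 < normc (g w) by rewrite lt_def gw0 normc_ge0.
have [r' [r'r wr']] : exists r', r' < r /\ normc (w - a) < r'.
  by exists ((normc (w - a) + r) / 2); split; lra.
have r'0 : 0 < r' by exact: le_lt_trans (normc_ge0 _) wr'.
have inr z : normc (z - a) <= r' -> normc (z - a) < r.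
  by move=> /le_lt_trans; apply.
have [M M0 gM] := @holo_bounded_disc g a r'
  (fun z zr => holo_ccont (hg _ (inr _ zr))).
have wa : 0 < normc (w - a).
  rewrite lt_def normc_ge0 andbT; apply/negP => /eqP wa.
  by move: gw0; rewrite g0 ?normc0 ?ltxx// wa.
suff : 1 <= normc (w - a) / r' by rewrite ler_pdivlMr// mul1r leNgt wr'.
apply: (@ge1_geometric _ M _ gw0); first by rewrite divr_ge0 ?normc_ge0// ltW.
move=> n; pose Phi z := g z * ((r'%:C)%C / (z - a)) ^+ n.
have hPhi z : normc (z - a) <= r' -> z - a != 0 -> holo Phi z.
  move=> zr za; apply: holoM; first exact/hg/inr.
  apply: holoX; apply: holoM; first exact: holo_cst.
  by apply: holoV => //; apply: holoB; [exact: holo_id|exact: holo_cst].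
have nr' : normc (r'%:C)%C = r' by rewrite normc_real gtr0_norm.
have := @maximum_modulus_disc Phi a r' M M0 _ _ _ w (ltW wr').
rewrite /Phi normcM normcX normcM normcV nr' => H.
have -> : M * (normc (w - a) / r') ^+ n = M / (r' / normc (w - a)) ^+ n.
  by rewrite -exprVn invf_div.
rewrite ler_pdivlMr ?exprn_gt0 ?divr_gt0//; apply: H.
- move=> z zr; have [/eqP|za] := eqVneq (z - a) 0.
    rewrite subr_eq0 => /eqP ->; apply: (ccont_locally_eq0 d0) => z' z'd.
    by rewrite g0// mul0r.
  exact: holo_ccont (hPhi _ zr za).
- move=> z zr; have [/eqP|za _] := eqVneq (z - a) 0; last exact: hPhi.
  by rewrite subr_eq0 => /eqP ->; rewrite g0 ?mul0r ?eqxx// subrr normc0.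
- move=> z zr; rewrite normcM normcX normcM normcV nr' zr divff ?gt_eqF//.
  by rewrite expr1n mulr1 gM// zr.
Qed.

End discs.

(** * Taylor bounds for sine, cosine and the exponential *)

Section elementary_inequalities.
Context {R : realType}.
Implicit Types (x y : R).

(** Each Taylor bound below follows from the previous one, which says that the derivative of the
    difference is nonnegative. *)
Lemma ge0_of_derive (F dF : R -> R) : (forall x, is_derive x 1 F (dF x)) ->
  F 0 = 0 -> (forall x, 0 <= x -> 0 <= dF x) -> forall x, 0 <= x -> 0 <= F x.
Proof.
move=> HF F0 dF0 x; rewrite le_eqVlt => /predU1P[<-|x0]; first by rewrite F0.
have cF : {within `[0, x], continuous F}.
  apply: derivable_within_continuous => y _.
  by have [] := HF y.
have [y] := MVT x0 (fun y _ => HF y) cF; rewrite in_itv/= => /andP[y0 _].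
rewrite F0 !subr0 => ->.
by apply: mulr_ge0; [exact: dF0 (ltW y0)|exact: ltW].
Qed.

Lemma sin_leid x : 0 <= x -> sin x <= x.
Proof.
move=> x0; rewrite -subr_ge0.
have dF (z : R) : is_derive z (1 : R)
    (fun x : R => x - sin x)
    (1 - cos z).
  by apply: is_derive_eq; rewrite /GRing.scale/=; try ring; try field.
apply: (ge0_of_derive dF _ _ x0).
- by rewrite sin0 subrr.
- by move=> y _; rewrite subr_ge0 cos_le1.
Qed.

Lemma cos_ge_taylor2 x : 0 <= x -> 1 - x ^+ 2 / 2 <= cos x.
Proof.
move=> x0; rewrite -subr_ge0.
have dF (z : R) : is_derive z (1 : R)
    (fun x : R => cos x - (1 - x ^+ 2 / 2))
    (- sin z - (0 - z)).
  by apply: is_derive_eq; rewrite /GRing.scale/=; try ring; try field.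
apply: (ge0_of_derive dF _ _ x0).
- by rewrite cos0 expr0n/=; ring.
- by move=> y /sin_leid ?; lra.
Qed.

Lemma sin_ge_taylor3 x : 0 <= x -> x - x ^+ 3 / 6 <= sin x.
Proof.
move=> x0; rewrite -subr_ge0.
have dF (z : R) : is_derive z (1 : R)
    (fun x : R => sin x - (x - x ^+ 3 / 6))
    (cos z - (1 - z ^+ 2 / 2)).
  by apply: is_derive_eq; rewrite /GRing.scale/=; try ring; try field.
apply: (ge0_of_derive dF _ _ x0).
- by rewrite sin0 expr0n/=; ring.
- by move=> y /cos_ge_taylor2 ?; rewrite subr_ge0.
Qed.

Lemma cos_le_taylor4 x : 0 <= x -> cos x <= 1 - x ^+ 2 / 2 + x ^+ 4 / 24.
Proof.
move=> x0; rewrite -subr_ge0.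
have dF (z : R) : is_derive z (1 : R)
    (fun x : R => (1 - x ^+ 2 / 2 + x ^+ 4 / 24) - cos x)
    (sin z - (z - z ^+ 3 / 6)).
  by apply: is_derive_eq; rewrite /GRing.scale/=; try ring; try field.
apply: (ge0_of_derive dF _ _ x0).
- by rewrite cos0 expr0n/=; ring.
- by move=> y /sin_ge_taylor3 ?; rewrite subr_ge0.
Qed.

Lemma sin_le_taylor5 x : 0 <= x -> sin x <= x - x ^+ 3 / 6 + x ^+ 5 / 120.
Proof.
move=> x0; rewrite -subr_ge0.
have dF (z : R) : is_derive z (1 : R)
    (fun x : R => (x - x ^+ 3 / 6 + x ^+ 5 / 120) - sin x)
    ((1 - z ^+ 2 / 2 + z ^+ 4 / 24) - cos z).
  by apply: is_derive_eq; rewrite /GRing.scale/=; try ring; try field.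
apply: (ge0_of_derive dF _ _ x0).
- by rewrite sin0 expr0n/=; ring.
- by move=> y /cos_le_taylor4 ?; rewrite subr_ge0.
Qed.

Lemma expRN_ge_taylor3 x : 0 <= x -> 1 - x + x ^+ 2 / 2 - x ^+ 3 / 6 <= expR (- x).
Proof.
move=> x0.
have h1 y : 0 <= y -> expR (- y) <= 1 - y + y ^+ 2 / 2.
  have h2 z : 0 <= z -> 1 - z <= expR (- z) by move=> _; exact: expR_ge1Dx.
  move=> y0; rewrite -subr_ge0.
  have dF (z : R) : is_derive z (1 : R)
    (fun x : R => (1 - x + x ^+ 2 / 2) - expR (- x))
    (expR (- z) - (1 - z)).
    by apply: is_derive_eq; rewrite /GRing.scale/=; try ring; try field.
  apply: (ge0_of_derive dF _ _ y0).
  + by rewrite oppr0 expR0 expr0n/=; ring.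
  + by move=> z /h2 ?; rewrite subr_ge0.
rewrite -subr_ge0.
have dF (z : R) : is_derive z (1 : R)
    (fun x : R => expR (- x) - (1 - x + x ^+ 2 / 2 - x ^+ 3 / 6))
    ((1 - z + z ^+ 2 / 2) - expR (- z)).
  by apply: is_derive_eq; rewrite /GRing.scale/=; try ring; try field.
apply: (ge0_of_derive dF _ _ x0).
- by rewrite oppr0 expR0 expr0n/=; ring.
- by move=> z /h1 ?; rewrite subr_ge0.
Qed.

End elementary_inequalities.

(** * The Schwarz-Pick inequality on a strip *)

(** Where [g] does not vanish, put [phi = f / g]. Up to factors of equal modulus, [wronskian] and
    [polar] are [phi z - phi p] and [1 - phi z * conj (phi p)], so their quotient has the
    pseudohyperbolic distance as modulus. *)
Definition wronskian {R : realType} (f g : R[i] -> R[i]) (p z : R[i]) : R[i] :=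
  f z * g p - g z * f p.

Definition polar {R : realType} (f g : R[i] -> R[i]) (p z : R[i]) : R[i] :=
  g z * (g p)^*%C - f z * (f p)^*%C.

Definition gap {R : realType} (f g : R[i] -> R[i]) (z : R[i]) : R :=
  normc (g z) ^+ 2 - normc (f z) ^+ 2.

Section strip.
Context {R : realType}.
Implicit Types (z w p : R[i]) (x y e : R).

(* The identity behind the Schwarz-Pick lemma. *)
Lemma sqr_polar (f g : R[i] -> R[i]) p z :
  normc (polar f g p z) ^+ 2 =
    normc (wronskian f g p z) ^+ 2 + gap f g z * gap f g p.
Proof.
rewrite /polar /wronskian /gap !sqr_normcE !ReImE.
case: (f z) => a b; case: (g z) => c d; case: (f p) => a' b'.
by case: (g p) => c' d' /=; ring.
Qed.

Lemma normc_conjc z : normc z^*%C = normc z.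
Proof. by case: z => a b /=; rewrite sqrrN. Qed.

Lemma wronskian_le_polar (f g : R[i] -> R[i]) p z :
  0 <= gap f g z -> 0 <= gap f g p ->
  normc (wronskian f g p z) <= normc (polar f g p z).
Proof.
move=> gz gp; rewrite -(ler_pXn2r (n := 2)) ?nnegrE ?normc_ge0//.
by rewrite sqr_polar lerDl mulr_ge0.
Qed.

(** Gives continuity at removable singularities, where [Phi] is a locally bounded factor times
    [D]. *)
Lemma ccont_squeeze (Phi D : R[i] -> R[i]) z (C r : R) : 0 < r ->
  ccont D z -> D z = 0 ->
  (forall w, normc (w - z) < r -> normc (Phi w) <= C * normc (D w)) ->
  ccont Phi z.
Proof.
move=> r0 cD D0 H e e0.
have Pz : Phi z = 0.
  have := H z; rewrite subrr normc0 => /(_ r0).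
  rewrite D0 normc0 mulr0 => Hz; apply/eqP; rewrite -normc_eq0.
  by rewrite eq_le Hz normc_ge0.
have C1 : 0 < `|C| + 1 by rewrite ltr_wpDl.
have [s s0 Hs] := cD _ (divr_gt0 e0 C1).
exists (Num.min r s); first by rewrite lt_min r0.
move=> w; rewrite lt_min => /andP[/H hw /Hs].
rewrite D0 Pz !subr0 ltr_pdivlMr// mulrC; apply: le_lt_trans.
apply: le_trans hw _; rewrite ler_wpM2r ?normc_ge0//.
by rewrite (le_trans (ler_norm _))// lerDl.
Qed.

Lemma ccont_locally_bounded (f : R[i] -> R[i]) z : ccont f z ->
  exists2 r, 0 < r & forall w, normc (w - z) < r ->
    normc (f w) <= normc (f z) + 1.
Proof.
move=> /(_ _ ltr01)[r r0 H]; exists r => // w /H /ltW h.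
by apply: le_trans (normc_le_dist _ (f z)) _; rewrite lerD2l.
Qed.

Lemma strip_nbhs (a b c d : R) z : a < Re z < b -> c < Im z < d ->
  exists2 r, 0 < r & forall w, normc (w - z) < r ->
    a < Re w < b /\ c < Im w < d.
Proof.
move=> /andP[h1 h2] /andP[h3 h4].
exists (Num.min (Num.min (Re z - a) (b - Re z)) (Num.min (Im z - c) (d - Im z))).
  by rewrite !lt_min !subr_gt0 h1 h2 h3 h4.
move=> w; rewrite !lt_min => /andP[/andP[k1 k2] /andP[k3 k4]].
have := Re_le_normc (w - z); have := Im_le_normc (w - z); rewrite !ReImE.
rewrite !ler_norml => /andP[m1 m2] /andP[m3 m4].
by split; apply/andP; split; lra.
Qed.

Lemma ccompact_rect (a b c d : R) :
  ccompact [set z : R[i] | a <= Re z <= b /\ c <= Im z <= d].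
Proof.
have -> : ccompact [set z : R[i] | a <= Re z <= b /\ c <= Im z <= d] =
    compact (`[a, b]%classic `*` `[c, d]%classic : set (R * R)).
  by congr compact; apply/seteqP; split=> -[x y] /=; rewrite !in_itv.
by apply: compact_setX; exact: segment_compact.
Qed.

(* [xi |-> exp (- i k xi)] maps the strip [- pi / k < Re xi < 0] onto the upper
   half plane. *)
Definition strip_map (k : R) z : R[i] := expc ((0 -i* k)%C * z).

Lemma strip_mapE k z : strip_map k z =
  (expR (k * Im z) * cos (k * - Re z) +i* (expR (k * Im z) * sin (k * - Re z)))%C.
Proof.
rewrite /strip_map /expc !ReImE /= !mul0r sub0r add0r mulNr opprK.
by rewrite mulrN mulNr.
Qed.

Lemma holo_strip_map k z : holo (strip_map k) z.
Proof.
apply: (holo_comp (f := fun z => (0 -i* k)%C * z)); last exact: holo_expc.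
by apply: holoM; [exact: holo_cst|exact: holo_id].
Qed.

Section schwarz_pick.
Variables (f g : R[i] -> R[i]) (c : R) (z0 : R[i]).
Hypotheses (c0 : 0 < c) (c1 : c < 1).
Hypothesis hf : forall z, normc z < 1 -> holo f z.
Hypothesis hg : forall z, normc z < 1 -> holo g z.
Hypothesis hfg : forall z, c < normc z -> normc z < 1 -> normc (f z) <= normc (g z).
Hypothesis Rez0 : Re z0 = ln c / 2.
Let p := expc z0.
Hypothesis gap_p : 0 < gap f g p.

Let k := pi / - ln c.
Let S z := sin (k * - Re z).
Let E z := expR (k * (Im z - Im z0)) + expR (- (k * (Im z - Im z0))).
Let w0 := strip_map k z0.
Let D z := wronskian f g p (expc z).
Let q z := polar f g p (expc z).

Let lnc : ln c < 0.
Proof. by rewrite ln_lt0// c0. Qed.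

Let k0 : 0 < k.
Proof. by rewrite divr_gt0 ?pi_gt0// oppr_gt0. Qed.

Let kneq0 : k != 0.
Proof. by rewrite gt_eqF. Qed.

Let klnc : k * - ln c = pi.
Proof. by rewrite /k divfK// oppr_eq0 lt_eqF. Qed.

Let strip z := ln c < Re z < 0.

Let annulus z : strip z -> c < normc (expc z) < 1.
Proof.
move=> /andP[h1 h2]; rewrite normc_expc expR_lt1 h2 andbT.
by rewrite -[ltLHS]lnK// ltr_expR.
Qed.

Let strip_arg z : strip z -> 0 < k * - Re z < pi.
Proof.
move=> /andP[h1 h2]; rewrite mulr_gt0 ?oppr_gt0//= -klnc.
by rewrite ltr_pM2l// ltrN2.
Qed.

(** The midline of the strip goes to the argument [pi / 2]. *)
Let w0E : w0 = (0 +i* expR (k * Im z0))%C.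
Proof.
rewrite /w0 strip_mapE Rez0 -mulNr mulrA klnc cos_pihalf sin_pihalf.
by rewrite mulr0 mulr1.
Qed.

Let sqr_dist z (s : R) : s ^+ 2 = 1 -> normc (strip_map k z + s%:C%C * w0) ^+ 2 =
  expR (k * Im z) * expR (k * Im z0) * (E z + s * 2 * S z).
Proof.
move=> s2; rewrite strip_mapE w0E sqr_normcE !ReImE /= /E /S.
set u := k * - Re z; rewrite mulrBr expRN !expRB.
have := cos2Dsin2 u; set C := cos u; set T := sin u => CT.
set A := expR (k * Im z); set B := expR (k * Im z0).
have A0 : A != 0 by rewrite gt_eqF// expR_gt0.
have B0 : B != 0 by rewrite gt_eqF// expR_gt0.
rewrite !(mul0r, mulr0, subr0, addr0).
transitivity (A ^+ 2 * (C ^+ 2 + T ^+ 2) + s ^+ 2 * B ^+ 2 + s * 2 * A * B * T).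
  by ring.
by rewrite CT s2; field; rewrite A0 B0.
Qed.

Let E_ge z : 1 + k * `|Im z - Im z0| <= E z.
Proof.
rewrite /E; set u := Im z - Im z0.
have h1 := expR_ge1Dx (k * u); have h2 := expR_ge1Dx (- (k * u)).
have h3 := expR_ge0 (k * u); have h4 := expR_ge0 (- (k * u)).
have [u0|u0] := leP 0 u; first by rewrite ger0_norm//; lra.
by rewrite ltr0_norm// mulrN; lra.
Qed.

Let E_ge2 z : 2 <= E z.
Proof.
rewrite /E expRN; set u := expR _; have u0 : 0 < u by exact: expR_gt0.
rewrite -subr_ge0.
have -> : u + u^-1 - 2 = (u - 1) ^+ 2 / u by field; rewrite gt_eqF.
by rewrite divr_ge0 ?sqr_ge0// ltW.
Qed.

(** Injectivity: the modulus of [strip_map k z] determines [Im z], and its argument, in [(0, pi)]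
    where cosine is injective, determines [Re z]. *)
Let strip_map_dist_gt0 z : strip z -> z != z0 -> strip_map k z - w0 != 0.
Proof.
move=> sz; apply: contraNN; rewrite subr_eq0 => /eqP wE.
have nE : expR (k * Im z) = expR (k * Im z0).
  have := congr1 (fun z : R[i] => normc z) wE; rewrite /w0 /strip_map !normc_expc !ReImE /=.
  by rewrite !mul0r !sub0r !mulNr !opprK.
have ImE : Im z = Im z0 by move/expR_inj/(mulfI kneq0) : nE.
have : cos (k * - Re z) = cos (pi / 2).
  have := congr1 (fun z : R[i] => Re z) wE; rewrite w0E strip_mapE /= => /eqP.
  by rewrite mulf_eq0 gt_eqF ?expR_gt0//= cos_pihalf => /eqP.
have [a1 a2] := andP (strip_arg sz).
have pi0 := @pi_gt0 R.
move=> /cos_inj; rewrite !in_itv/= !ltW//= ?divr_gt0 ?pi_gt0//; last first.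
  by rewrite ltr_pdivrMr// ltr_pMr// ltr1n.
move=> /(_ isT isT) RE.
have {}RE : Re z = Re z0.
  rewrite Rez0; have : k * - Re z = k * - (ln c / 2) by rewrite RE -klnc mulrN mulrN mulNr mulrA.
  by move/(mulfI kneq0)/oppr_inj.
by rewrite -(complexK z) -(complexK z0) RE ImE.
Qed.

Let sz0 : strip z0.
Proof. by rewrite /strip Rez0; apply/andP; split; have := lnc; lra. Qed.

Let gap_ge0 z : strip z -> 0 <= gap f g (expc z).
Proof.
move=> /annulus/andP[h1 h2]; rewrite subr_ge0 ler_pXn2r ?nnegrE ?normc_ge0//.
exact: hfg.
Qed.

Let D_le_q z : strip z -> normc (D z) <= normc (q z).
Proof. by move=> sz; apply: wronskian_le_polar; [exact: gap_ge0|exact: ltW]. Qed.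

Let holo_fexp z : strip z -> holo (fun z => f (expc z)) z.
Proof.
by move=> /annulus/andP[_ h]; apply: holo_comp; [exact: holo_expc|exact: hf].
Qed.

Let holo_gexp z : strip z -> holo (fun z => g (expc z)) z.
Proof.
by move=> /annulus/andP[_ h]; apply: holo_comp; [exact: holo_expc|exact: hg].
Qed.

Let holo_D z : strip z -> holo D z.
Proof.
move=> sz.
have h1 := holoM (holo_fexp sz) (holo_cst (g p) z).
have h2 := holoM (holo_gexp sz) (holo_cst (f p) z).
exact: holoB h1 h2.
Qed.

Let holo_q z : strip z -> holo q z.
Proof.
move=> sz.
have h1 := holoM (holo_gexp sz) (holo_cst (g p)^*%C z).
have h2 := holoM (holo_fexp sz) (holo_cst (f p)^*%C z).
exact: holoB h1 h2.
Qed.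

(** As [w0] is purely imaginary, [- w0] is its conjugate, and this is the reciprocal of the Blaschke
    factor of the upper half plane at [w0]. Schwarz-Pick is the statement [|N| <= 1]. *)
Let ratio z := (strip_map k z + w0) / (strip_map k z - w0).
Let N z := D z / q z * ratio z.

Let Dz0 : D z0 = 0.
Proof. by rewrite /D /wronskian mulrC subrr. Qed.

Let S_gt0 z : strip z -> 0 < S z.
Proof. by move=> /strip_arg; exact: sin_gt0_pi. Qed.

Let sqr_sum z : normc (strip_map k z + w0) ^+ 2 =
  expR (k * Im z) * expR (k * Im z0) * (E z + 2 * S z).
Proof. by have := sqr_dist z (expr1n R 2); rewrite !mul1r. Qed.

Let sqr_sub z : normc (strip_map k z - w0) ^+ 2 =
  expR (k * Im z) * expR (k * Im z0) * (E z - 2 * S z).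
Proof.
have s2 : (- 1 : R) ^+ 2 = 1 by rewrite sqrrN expr1n.
have := sqr_dist z s2; rewrite mulN1r mulNr => <-; congr (normc (_ + _) ^+ 2).
by rewrite rmorphN1 mulN1r.
Qed.

Let holo_ratio z : strip z -> z != z0 -> holo ratio z.
Proof.
move=> sz zz0; have hw := @holo_strip_map k z.
have h1 := holoD hw (holo_cst w0 z).
have h2 := holoB hw (holo_cst w0 z).
have h3 := @holoV R (fun w => strip_map k w - w0) z (strip_map_dist_gt0 sz zz0) h2.
exact: holoM h1 h3.
Qed.

Let D_neq0 z : strip z -> D z != 0 -> q z != 0 /\ z != z0.
Proof.
move=> sz Dz; split.
  by rewrite -normc_gt0 (lt_le_trans _ (D_le_q sz))// normc_gt0.
by apply: contraNneq Dz => ->; rewrite Dz0.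
Qed.

Let holo_N z : strip z -> D z != 0 -> holo N z.
Proof.
move=> sz /(D_neq0 sz)[qz zz0].
exact: holoM (holoM (holo_D sz) (holoV qz (holo_q sz))) (holo_ratio sz zz0).
Qed.

Let Dq_le1 z : strip z -> normc (D z / q z) <= 1.
Proof.
move=> sz; rewrite normcM normcV; have [->|qz] := eqVneq (q z) 0.
  by rewrite normc0 invr0 mulr0.
by rewrite ler_pdivrMr ?normc_gt0// mul1r D_le_q.
Qed.

Let near_strip z : strip z ->
  exists2 r, 0 < r & forall w, normc (w - z) < r -> strip w.
Proof.
move=> sz.
have Imz : Im z - 1 < Im z < Im z + 1 by apply/andP; split; lra.
have [r r0 H] := strip_nbhs sz Imz.
by exists r => // w /H[].
Qed.

(** The zero of [strip_map k w - w0] at [z0] is simple, so it can be divided out of [D], which also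
    vanishes there. *)
Let strip_map_expand : exists r C : R, [/\ 0 < r, 0 < C & forall w,
  normc (w - z0) < r -> C * normc (w - z0) <= normc (strip_map k w - w0)].
Proof.
have half0 : 0 < 2^-1 :> R by rewrite invr_gt0.
have [r r0 H] := expc_taylor1 half0.
have nk : normc (0 -i* k)%C = k by rewrite /= expr0n/= add0r sqrrN sqrtr_sqr gtr0_norm.
have nw0 : 0 < normc w0 by rewrite normc_expc expR_gt0.
exists (r / k), (normc w0 * (k / 2)); split.
- by rewrite divr_gt0.
- by rewrite mulr_gt0// divr_gt0.
move=> w; rewrite ltr_pdivlMr// => wr; set h := (0 -i* k)%C * (w - z0).
have nh : normc h = k * normc (w - z0) by rewrite normcM nk.
have -> : strip_map k w - w0 = w0 * (expc h - 1).
  by rewrite mulrBr mulr1 -expcD /h -mulrDr subrKC.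
rewrite normcM -[leLHS]mulrA ler_pM2l//.
have := H h; rewrite nh mulrC => /(_ wr) Hh.
have := normc_le_dist h (expc h - 1); rewrite (normcBC h) nh => h1.
by move: Hh h1; set a := normc (w - z0); lra.
Qed.

Let N_locally_bounded z : strip z ->
  exists r C : R, 0 < r /\ forall w, normc (w - z) < r -> normc (N w) <= C.
Proof.
move=> sz; have [r r0 Hr] := near_strip sz; have [zz0|zz0] := eqVneq z z0.
  have qz0 : q z != 0.
    rewrite zz0 -normc_gt0 -(ltr_pXn2r (n := 2)) ?nnegrE ?normc_ge0//.
    rewrite expr0n/= sqr_polar ltr_wpDl ?sqr_ge0//.
    by rewrite mulr_gt0.
  have [r1 r10 H1] := ccont_locally_bounded (holo_ccont (holoM
    (holoV qz0 (holo_q sz)) (holoD (@holo_strip_map k z) (holo_cst w0 z)))).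
  have [d dH] := iffLR (holoP D z) (holo_D sz).
  have [r2 r20 H2] := dH _ ltr01.
  have [r3 [C3 [r30 C30 H3]]] := strip_map_expand.
  set C1 := _ + 1 in H1.
  exists (Num.min (Num.min r1 r2) r3), ((normc d + 1) / C3 * C1).
  split; first by rewrite !lt_min r10 r20.
  move=> w; rewrite !lt_min => /andP[/andP[/H1 k1 /H2]].
  rewrite {1}zz0 Dz0 subr0 mul1r => k2; rewrite zz0 => /H3 k3.
  have k4 : normc (D w) <= (normc d + 1) * normc (w - z0).
    apply: le_trans (normc_le_dist _ (d * (w - z))) _.
    by rewrite normcM mulrDl mul1r lerD// -zz0.
  have -> : N w = (D w / (strip_map k w - w0)) * ((q w)^-1 * (strip_map k w + w0)).
    by rewrite /N /ratio [RHS]mulrACA [X in _ = _ * X]mulrC.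
  rewrite normcM ler_pM ?normc_ge0//.
  have [->|ww0] := eqVneq w z0.
    rewrite Dz0 mul0r normc0; apply: divr_ge0; last exact: ltW.
    by rewrite addr_ge0// normc_ge0.
  rewrite normcM normcV.
  have d0 : 0 < normc (w - z0) by rewrite normc_gt0 subr_eq0.
  have d1 : 0 < normc (strip_map k w - w0) by rewrite (lt_le_trans _ k3)// mulr_gt0.
  rewrite ler_pdivrMr//; apply: le_trans k4 _.
  rewrite -mulrA ler_pM2l; last by rewrite ltr_wpDl// normc_ge0.
  by rewrite mulrC ler_pdivlMr// mulrC.
have [r1 r10 H1] := ccont_locally_bounded (holo_ccont (holo_ratio sz zz0)).
exists (Num.min r r1), (1 * (normc (ratio z) + 1)).
split; first by rewrite lt_min r0.
move=> w; rewrite lt_min => /andP[/Hr sw /H1 k1].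
by rewrite normcM ler_pM ?normc_ge0// Dq_le1.
Qed.

(** [N] may be discontinuous at zeros of [D], where [q] or the denominator of [ratio] may vanish
    too. It stays locally bounded, so the extra factor [D] restores continuity. *)
Let ccont_Phi n z : strip z -> ccont (fun w => N w ^+ n * D w) z.
Proof.
move=> sz; have [Dz|Dz] := eqVneq (D z) 0; last first.
  have h := @holoX R N z n (holo_N sz Dz).
  exact: holo_ccont (holoM h (holo_D sz)).
have [r [C [r0 H]]] := N_locally_bounded sz.
apply: (@ccont_squeeze _ D z (C ^+ n) r r0) => //.
  exact: holo_ccont (holo_D sz).
move=> w /H h; rewrite normcM normcX ler_wpM2r ?normc_ge0//.
by rewrite lerXn2r// nnegrE ?normc_ge0// (le_trans (normc_ge0 _) h).
Qed.

(** Here [ratio] has squared modulus [(E + 2 S) / (E - 2 S)], at most the right-hand side, which is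
    at least 1 and hence below its own square. *)
Let N_boundary (t : R) z : 0 < t -> t < 2^-1 -> strip z -> S z <= t * E z ->
  normc (N z) <= (1 + 2 * t) / (1 - 2 * t).
Proof.
move=> t0 t2 sz St; have Sz := S_gt0 sz; have E2 := E_ge2 z.
have t1 : 0 < 1 - 2 * t by lra.
have Epos : 0 < E z by exact: lt_le_trans E2.
have ES : (1 - 2 * t) * E z <= E z - 2 * S z by lra.
have ESpos : 0 < E z - 2 * S z by rewrite (lt_le_trans _ ES)// mulr_gt0.
set eta := (1 + 2 * t) / (1 - 2 * t).
have eta1 : 1 <= eta by rewrite /eta ler_pdivlMr// mul1r; lra.
rewrite normcM; apply: le_trans (ler_wpM2r (normc_ge0 _) (Dq_le1 sz)) _.
rewrite mul1r -(ler_pXn2r (n := 2)) ?nnegrE ?normc_ge0 ?(le_trans ler01)//.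
apply: (@le_trans _ _ eta); last by rewrite expr2 ler_peMr// (le_trans ler01).
rewrite normcM normcV exprMn exprVn sqr_sum sqr_sub -mulf_div divff ?mul1r; last first.
  by rewrite mulf_neq0// gt_eqF// expR_gt0.
rewrite ler_pdivrMr//; apply: le_trans (_ : eta * ((1 - 2 * t) * E z) <= _).
  by rewrite mulrA /eta divfK ?gt_eqF//; lra.
by rewrite ler_wpM2l// (le_trans ler01).
Qed.

(** Maximum principle for [N ^+ n * D] on a rectangle around [z] whose edges satisfy [S <= t * E];
    the power trick then removes [D]. *)
Let N_le_boundary (t : R) z : 0 < t -> t < 2^-1 -> strip z -> D z != 0 ->
  normc (N z) <= (1 + 2 * t) / (1 - 2 * t).
Proof.
move=> t0 t2 sz Dz; set eta := (_ / _).
have eta0 : 0 < eta by rewrite /eta divr_gt0//; lra.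
have [z1 z2] := andP sz.
(* The first two terms keep [z] inside the rectangle. The third gives [S <= 2 * t] on the vertical
   edges, and [2 * t <= t * E] since [E >= 2]. *)
pose d := Num.min (Num.min (- Re z) (Re z - ln c)) (2 * t / k).
have d0 : 0 < d by rewrite !lt_min oppr_gt0 z2 subr_gt0 z1 divr_gt0// mulr_gt0.
have dk : k * d <= 2 * t by rewrite mulrC -ler_pdivlMr// /d ge_min lexx orbT.
have dz1 : d <= - Re z by rewrite /d !ge_min lexx.
have dz2 : d <= Re z - ln c by rewrite /d !ge_min lexx orbT.
(* On the horizontal edges [S <= 1], and the linear growth of [E] makes [t * E >= 1] at this
   height. *)
pose Y := `|Im z - Im z0| + (t * k)^-1.
have tk0 : 0 < (t * k)^-1 by rewrite invr_gt0 mulr_gt0.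
have Yt : 1 <= t * (1 + k * Y).
  have -> : t * (1 + k * Y) = 1 + t * (1 + k * `|Im z - Im z0|).
    by rewrite /Y; field; rewrite !gt_eqF.
  by rewrite lerDl mulr_ge0 ?ltW// ltr_wpDr// mulr_ge0// ltW.
clearbody d.
pose K := [set w : R[i] | ln c + d <= Re w <= - d /\ Im z0 - Y <= Im w <= Im z0 + Y].
have Kstrip w : K w -> strip w.
  by move=> [/andP[h1 h2] _]; rewrite /strip; apply/andP; split; lra.
have Kz : K z.
  move: dz1 dz2; split; first by apply/andP; split; lra.
  have : `|Im z - Im z0| <= Y by rewrite /Y lerDl ltW.
  by rewrite ler_norml => /andP[h1 h2]; apply/andP; split; lra.
have SK w : K w -> Re w = - d \/ Re w = ln c + d ->
    S w <= 2 * t.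
  move=> _ [] RE; rewrite /S RE.
    by rewrite opprK (le_trans (sin_leid _))// mulr_ge0 ?ltW.
  have -> : k * - (ln c + d) = pi - k * d by rewrite opprD mulrDr klnc mulrN.
  rewrite sinB sinpi cospi mul0r sub0r mulN1r opprK.
  by rewrite (le_trans (sin_leid _))// mulr_ge0 ?ltW.
have SE w : K w -> Re w = - d \/ Re w = ln c + d \/ Im w = Im z0 - Y \/
    Im w = Im z0 + Y -> S w <= t * E w.
  move=> Kw [h|[h|h]].
  - by rewrite (le_trans (SK _ Kw (or_introl h)))// mulrC ler_pM2l// E_ge2.
  - by rewrite (le_trans (SK _ Kw (or_intror h)))// mulrC ler_pM2l// E_ge2.
  - apply: le_trans (sin_le1 _) _; apply: le_trans Yt _; rewrite ler_pM2l//.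
    have -> : Y = `|Im w - Im z0|; last exact: E_ge.
    have Y0 : 0 <= Y by rewrite addr_ge0 ?normr_ge0// ltW.
    case: h => ->; first by rewrite addrAC subrr add0r normrN ger0_norm.
    by rewrite addrAC subrr add0r ger0_norm.
have [w1 _ HM] := ccompact_max (v := fun w => normc (D w))
  (@ccompact_rect (ln c + d) (- d) (Im z0 - Y) (Im z0 + Y))
  (ex_intro _ z Kz) (fun w (Kw : K w) =>
     ccont_continuous_normc (p := (Re w, Im w))
       (eq_ind_r (ccont D) (holo_ccont (holo_D (Kstrip w Kw))) (complexK w))).
set M := normc (D w1) in HM.
have M0 : 0 <= M by exact: normc_ge0.
have eta_le n w : K w -> normc (N w ^+ n * D w) <= M * eta ^+ n.
  apply: (@maximum_modulus R K (fun w => N w ^+ n * D w)).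
  - exact: (@ccompact_rect (ln c + d) (- d) (Im z0 - Y) (Im z0 + Y)).
  - by rewrite mulr_ge0// exprn_ge0// ltW.
  - by move=> w' /Kstrip; exact: ccont_Phi.
  - move=> w' /Kstrip sw'; have [->|Dw'] := eqVneq (D w') 0.
      by rewrite mulr0 eqxx.
    have h := @holoX R N w' n (holo_N sw' Dw').
    by move=> _; exact: holoM h (holo_D sw').
  move=> w' Kw'; have [/andP[a1 a2] /andP[a3 a4]] := Kw'.
  have bnd : S w' <= t * E w' -> normc (N w' ^+ n * D w') <= M * eta ^+ n.
    move=> St; rewrite normcM normcX mulrC ler_pM ?normc_ge0 ?exprn_ge0 ?normc_ge0//.
      exact: HM.
    apply: lerXn2r; rewrite ?nnegrE ?normc_ge0//; first exact: ltW.
    by apply: N_boundary => //; exact: Kstrip.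
  have [b1|b1] := eqVneq (Re w') (- d); first by left; apply/bnd/SE => //; left.
  have [b2|b2] := eqVneq (Re w') (ln c + d).
    by left; apply/bnd/SE => //; right; left.
  have [b3|b3] := eqVneq (Im w') (Im z0 - Y).
    by left; apply/bnd/SE => //; right; right; left.
  have [b4|b4] := eqVneq (Im w') (Im z0 + Y).
    by left; apply/bnd/SE => //; right; right; right.
  right; have [||r r0 Hr] := @strip_nbhs (ln c + d) (- d) (Im z0 - Y) (Im z0 + Y) w'.
  - by rewrite !lt_neqAle a1 a2 b1 eq_sym b2.
  - by rewrite !lt_neqAle a3 a4 b4 eq_sym b3.
  by exists r => // w2 /Hr[/andP[/ltW m1 /ltW m2] /andP[/ltW m3 /ltW m4]];
    rewrite /K /= m1 m2 m3 m4.
have Dz_gt0 : 0 < normc (D z) by rewrite normc_gt0.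
have [->|Nz] := eqVneq (normc (N z)) 0; first exact: ltW.
have {Nz}Nz : 0 < normc (N z) by rewrite lt_def Nz normc_ge0.
suff : 1 <= eta / normc (N z) by rewrite ler_pdivlMr// mul1r.
apply: (ge1_geometric (M := M) Dz_gt0); first by rewrite ltW// divr_gt0.
move=> n; rewrite expr_div_n mulrA ler_pdivlMr ?exprn_gt0// mulrC.
by rewrite -normcX -normcM eta_le.
Qed.

Let N_le1 z : strip z -> D z != 0 -> normc (N z) <= 1.
Proof.
move=> sz Dz; apply/ler_addgt0Pr => e e0.
pose t := Num.min (8^-1) (e / 16).
have t0 : 0 < t by rewrite /t lt_min; apply/andP; split; lra.
have t8 : t <= 8^-1 by rewrite ge_min lexx.
have te : t <= e / 16 by rewrite ge_min lexx orbT.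
have t2 : t < 2^-1 by clearbody t; lra.
apply: le_trans (N_le_boundary t0 t2 sz Dz) _.
have t1 : 0 < 1 - 2 * t by clearbody t; lra.
rewrite ler_pdivrMr//; clearbody t.
have : 2 * e * t <= e / 4 by nra.
by move=> ?; lra.
Qed.

(** [|N| <= 1] reads [|D|^2 (E + 2 S) <= |q|^2 (E - 2 S)]; substituting [sqr_polar] for [|q|^2]
    leaves [4 S |D|^2] on the left. *)
Lemma schwarz_pick_strip z : ln c < Re z < 0 ->
  normc (wronskian f g (expc z0) (expc z)) ^+ 2 * (4 * S z) <=
  (E z - 2 * S z) * (gap f g (expc z) * gap f g (expc z0)).
Proof.
move=> sz; have Sz := S_gt0 sz; have E2 := E_ge2 z.
have ES : 0 <= E z - 2 * S z by have := sin_le1 (k * - Re z); rewrite -/(S z); lra.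
have gp : 0 <= gap f g (expc z) * gap f g (expc z0).
  by rewrite mulr_ge0 ?gap_ge0// ltW.
rewrite -/p -/(D z); have [->|Dz] := eqVneq (D z) 0.
  by rewrite normc0 expr0n/= mul0r mulr_ge0.
have [qz zz0] := D_neq0 sz Dz.
have : normc (N z) ^+ 2 <= 1 by rewrite expr_le1 ?normc_ge0// N_le1.
rewrite /N /ratio.
have Q0 : 0 < normc (q z) ^+ 2 by rewrite exprn_gt0// normc_gt0.
have T0 : 0 < normc (strip_map k z - w0) ^+ 2.
  by rewrite exprn_gt0// normc_gt0 strip_map_dist_gt0.
rewrite !normcM !normcV !exprMn !exprVn mulf_div ler_pdivrMr; last exact: mulr_gt0.
rewrite mul1r sqr_sum sqr_sub.
set AB := expR (k * Im z) * _; have AB0 : 0 < AB by rewrite mulr_gt0 ?expR_gt0.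
rewrite mulrCA (mulrCA (normc (q z) ^+ 2)) ler_pM2l//.
rewrite [normc (q z) ^+ 2]sqr_polar -/(D z) -/p.
move: (normc (D z) ^+ 2) (gap f g (expc z) * gap f g p) (E z) (S z) => a b e s h.
lra.
Qed.

End schwarz_pick.
End strip.

(** * Numerical bounds *)

Section numerics.
Context {R : realType}.
Implicit Types (x y : R).

(** The triple angle formula at [pi / 6] reads [4 s^3 - 3 s + 1 = 0], that is
    [(s + 1) (2 s - 1)^2 = 0]. *)
Lemma sin_pi6 : sin (pi / 6) = 1 / 2 :> R.
Proof.
set x : R := pi / 6; pose s := sin x.
have s0 : 0 < s.
  apply: sin_gt0_pi; rewrite divr_gt0 ?pi_gt0//= ltr_pdivrMr// ltr_pMr ?pi_gt0//.
  by rewrite ltr1n.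
have E3 : sin (x + x + x) = 3 * s - 4 * s ^+ 3.
  rewrite sinD sinD cosD -/s; have := cos2Dsin2 x; rewrite -/s => h.
  have -> : (s * cos x + cos x * s) * cos x + (cos x * cos x - s * s) * s =
     3 * s * (cos x ^+ 2 + s ^+ 2) - 4 * s ^+ 3 by ring.
  by rewrite h; ring.
have x3 : x + x + x = pi / 2 by rewrite /x; field.
move: E3; rewrite x3 sin_pihalf => E3.
have : (s + 1) * (2 * s - 1) ^+ 2 = 0.
  have -> : (s + 1) * (2 * s - 1) ^+ 2 = 1 - (3 * s - 4 * s ^+ 3) by ring.
  by rewrite -E3 subrr.
move/eqP; rewrite mulf_eq0 gt_eqF/= ?addr_gt0// sqrf_eq0 => /eqP h.
rewrite -/s; lra.
Qed.

(** The Taylor bounds put the sine of [15 / 29] below and that of [43 / 82] above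
    [1 / 2 = sin (pi / 6)]. *)
Lemma pi_bounds : 90 / 29 <= (pi : R) <= 129 / 41.
Proof.
have pi2 := @pi_ge2 R; have pi4 : pi / 2 < 2 :> R := pihalf_lt2 R.
have mono (x y : R) : -1 <= x <= 1 -> -1 <= y <= 1 -> x <= y -> sin x <= sin y.
  move=> /andP[x1 x2] /andP[y1 y2] xy; rewrite leNgt; apply/negP.
  rewrite ltr_sin ?in_itv/=; first by rewrite ltNge xy.
    by apply/andP; split; lra.
  by apply/andP; split; lra.
apply/andP; split; rewrite leNgt; apply/negP => h.
- have h1 : pi / 6 <= 15 / 29 :> R by lra.
  have x0 : 0 <= 15 / 29 :> R by lra.
  have k1 : -1 <= (pi : R) / 6 <= 1 by apply/andP; split; lra.
  have k2 : -1 <= (15 : R) / 29 <= 1 by apply/andP; split; lra.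
  have := le_trans (mono _ _ k1 k2 h1) (sin_le_taylor5 x0).
  by rewrite sin_pi6; lra.
- have h1 : 43 / 82 <= pi / 6 :> R by lra.
  have x0 : 0 <= 43 / 82 :> R by lra.
  have k1 : -1 <= (pi : R) / 6 <= 1 by apply/andP; split; lra.
  have k2 : -1 <= (43 : R) / 82 <= 1 by apply/andP; split; lra.
  have := le_trans (sin_ge_taylor3 x0) (mono _ _ k2 k1 h1).
  by rewrite sin_pi6; lra.
Qed.

(** [21 / 19] is the Pade value [(1 + x / 2) / (1 - x / 2)] at [x = 1 / 10]. *)
Let expR_tenth : expR (1 / 10 : R) <= 21 / 19.
Proof.
have x0 : 0 <= 1 / 10 :> R by lra.
have := expRN_ge_taylor3 x0; have := expRxMexpNx_1 (1 / 10 : R).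
have := expR_gt0 (1 / 10 : R).
set u := expR (1 / 10); set v := expR (- (1 / 10)) => u0 uv hv.
have {}hv : 19 / 21 <= v by lra.
have : u * (19 / 21) <= u * v by rewrite ler_pM2l.
by rewrite uv; lra.
Qed.

Lemma expR_16 : expR (16 / 10 : R) <= (21 / 19) ^+ 16.
Proof.
rewrite (_ : 16 / 10 = 16%:R * (1 / 10)); last by field.
by rewrite expRM_natl lerXn2r ?nnegrE ?expR_ge0.
Qed.

Lemma expR_32 : expR (16 / 5 : R) <= 123 / 5.
Proof.
rewrite (_ : 16 / 5 = 16 / 10 + 16 / 10); last by field.
rewrite expRD; apply: (@le_trans _ _ ((21 / 19) ^+ 16 * (21 / 19) ^+ 16)).
  by rewrite ler_pM ?expR_ge0 ?expR_16.
by lra.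
Qed.

Let c : R := 21%:R / 100%:R.

Lemma lnc_le : 31 / 20 <= - ln c.
Proof.
have c0 : 0 < c by rewrite divr_gt0.
have h : expR (31 / 20 : R) <= 100 / 21.
  have -> : 31 / 20 = 16 / 10 + - (1 / 20) :> R by field.
  rewrite expRD; have := expR_16; have := expRxMexpNx_1 (1 / 20 : R).
  have := expR_ge1Dx (1 / 20 : R).
  have := expR_gt0 (- (1 / 20) : R).
  set u := expR (1 / 20); set v := expR (- (1 / 20)); set e := expR (16 / 10).
  move=> v0 u1 uv e1.
  have v1 : v <= 20 / 21.
    have : (21 / 20) * v <= u * v by rewrite ler_pM2r//; lra.
    by rewrite uv; lra.
  apply: (@le_trans _ _ ((21 / 19) ^+ 16 * v)); first by rewrite ler_pM2r//; lra.
  by lra.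
rewrite -lnV//; have -> : c^-1 = 100 / 21 by rewrite /c invf_div.
by rewrite -[leLHS]expRK ler_ln ?posrE ?expR_gt0// divr_gt0.
Qed.

(** A comparison of rationals: [(100 / 21) ^+ 5 <= (10 / 7) ^+ 22]. *)
Lemma ln_ratio : 5 / 22 * - ln c <= ln (10 / 7 : R).
Proof.
have c0 : 0 < c by rewrite divr_gt0.
rewrite -lnV//; have -> : c^-1 = 100 / 21 by rewrite /c invf_div.
have p1 : 0 < 100 / 21 :> R by rewrite divr_gt0.
have p2 : 0 < 10 / 7 :> R by rewrite divr_gt0.
have : ln ((100 / 21 : R) ^+ 5) <= ln ((10 / 7) ^+ 22).
  by rewrite ler_ln ?posrE ?exprn_gt0//; lra.
by rewrite !lnXn// -(mulr_natl _ 5) -(mulr_natl _ 22); lra.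
Qed.

Lemma sin_ge_sym x y : 0 <= x <= pi / 2 -> x <= y <= pi - x -> sin x <= sin y.
Proof.
move=> /andP[x0 x2] /andP[xy yx]; have pi0 := @pi_gt0 R.
have mono (s t : R) : 0 <= s <= pi / 2 -> 0 <= t <= pi / 2 -> s <= t -> sin s <= sin t.
  move=> /andP[s1 s2] /andP[t1 t2] st; rewrite leNgt; apply/negP.
  rewrite ltr_sin ?in_itv/=; first by rewrite ltNge st.
    by apply/andP; split; lra.
  by apply/andP; split; lra.
have [y2|y2] := leP y (pi / 2).
  by apply: mono => //; rewrite ?x0 ?x2//; apply/andP; split; lra.
have -> : sin y = sin (pi - y) by rewrite sinB sinpi cospi mul0r sub0r mulN1r opprK.
by apply: mono; rewrite ?x0 ?x2//; try (apply/andP; split); lra.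
Qed.

Let k : R := pi / - ln c.

(** Because [3 / 10 * (7 / 10) = c], the angle ranges over an interval symmetric about [pi / 2], and
    the sine is smallest at its ends, where it equals [sin (k * ln (10 / 7))]. *)
Lemma sin_annulus_ge (r : R) : 3 / 10 <= r <= 7 / 10 ->
  129 / 200 <= sin (k * - ln r).
Proof.
move=> /andP[r3 r7]; have r0 : 0 < r by lra.
have L155 := lnc_le; have L0 : 0 < - ln c by lra.
have [p1 p2] := andP pi_bounds; have pi0 := @pi_gt0 R.
have klnc : k * - ln c = pi by rewrite /k divfK// gt_eqF.
have k0 : 0 < k by rewrite divr_gt0.
have h1 : ln (10 / 7) <= - ln r.
  by rewrite -lnV// ler_ln ?posrE ?invr_gt0 ?divr_gt0// -[10 / 7]invf_div lef_pV2 ?posrE ?divr_gt0.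
have h2 : - ln r <= - ln c - ln (10 / 7).
  rewrite -opprD -lnM ?posrE ?divr_gt0// lerN2 ler_ln ?posrE ?mulr_gt0 ?divr_gt0//.
  by rewrite /c; lra.
have kl : 141 / 200 <= k * ln (10 / 7).
  apply: (@le_trans _ _ (k * (5 / 22 * - ln c))).
    by rewrite mulrCA klnc; lra.
  by rewrite ler_pM2l// ln_ratio.
have x0 : 0 <= 141 / 200 :> R by lra.
apply: (@le_trans _ _ (sin (141 / 200))).
  by have := sin_ge_taylor3 x0; lra.
apply: sin_ge_sym; first by apply/andP; split; lra.
have m1 : k * ln (10 / 7) <= k * - ln r by rewrite ler_pM2l.
have m2 : k * - ln r <= k * (- ln c - ln (10 / 7)) by rewrite ler_pM2l.
rewrite mulrBr klnc in m2.
by apply/andP; split; lra.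
Qed.

Lemma expR_half_period : expR (k * (pi / 2)) <= 123 / 5.
Proof.
apply: le_trans expR_32; rewrite ler_expR /k.
have L155 := lnc_le; have [p1 p2] := andP pi_bounds.
rewrite mulrAC ler_pdivrMr; last by lra.
have : (pi : R) * pi <= 129 / 41 * (129 / 41) by rewrite ler_pM//; lra.
by lra.
Qed.

(* With [C = cosh (k pi / 2)] and [h = cosh ((a - b) / 2)] the left-hand side is
   [4 (C ^ 2 + h ^ 2 - 1 - 2 S C h + S ^ 2)], convex in [h] on [[1, C]]. *)
Lemma product_bound (a b S : R) : 0 <= a -> 0 <= b -> a + b = k * pi ->
  129 / 200 <= S -> S <= 1 ->
  (expR a + expR (- a) - 2 * S) * (expR b + expR (- b) - 2 * S) <=
  (4 * (40 / 21 * (100 / 21)) * S) ^+ 2.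
Proof.
move=> a0 b0 ab S6 S1.
pose g := expR (k * (pi / 2)); pose m := expR ((a - b) / 2).
have aE : a = k * (pi / 2) + (a - b) / 2 by rewrite mulrA -ab; field.
have bE : b = k * (pi / 2) + - ((a - b) / 2) by rewrite mulrA -ab; field.
pose C := (g + g^-1) / 2; pose h := (m + m^-1) / 2.
have g0 : 0 < g by exact: expR_gt0.
have m0 : 0 < m by exact: expR_gt0.
have eA : expR a = g * m by rewrite {1}aE expRD.
have eB : expR b = g / m by rewrite {1}bE expRD expRN.
have mg : m <= g by rewrite ler_expR; lra.
have gm : 1 <= g * m by rewrite -eA -expR0 ler_expR.
have g1 : 1 <= g by rewrite -expR0 ler_expR; lra.
have gG : g <= 123 / 5 by exact: expR_half_period.
have C_le : C <= 617 / 50.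
  rewrite /C ler_pdivrMr// -(ler_pM2r g0) mulrDl mulVf ?gt_eqF//.
  have : 0 <= (123 / 5 - g) * (g - 5 / 123).
    by rewrite mulr_ge0//; lra.
  by nra.
have h_ge1 : 1 <= h.
  rewrite -subr_ge0.
  have -> : h - 1 = (m - 1) ^+ 2 / (2 * m) by rewrite /h; field; rewrite gt_eqF.
  by rewrite divr_ge0 ?sqr_ge0// mulr_ge0// ltW.
have h_leC : h <= C.
  rewrite -subr_ge0.
  have -> : C - h = (g - m) * (g * m - 1) / (2 * (g * m)).
    by rewrite /h /C; field; rewrite !gt_eqF.
  rewrite divr_ge0//; first by rewrite mulr_ge0// subr_ge0.
  by rewrite !mulr_ge0// ltW.
have -> : (expR a + expR (- a) - 2 * S) * (expR b + expR (- b) - 2 * S) =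
    4 * (C ^+ 2 + h ^+ 2 - 1 - 2 * S * C * h + S ^+ 2).
  by rewrite !expRN eA eB /C /h; field; rewrite !gt_eqF.
clearbody C h.
have conv : 0 <= (h - 1) * (C - h) by rewrite mulr_ge0// subr_ge0.
(* [e1] and [e2] are the end points [h = 1] and [h = C]. The first is the tight one: [C - S] is at
   most [11.695] and the right-hand base is at least [11.7]. *)
have e1 : (C - S) ^+ 2 <= (2 * (40 / 21 * (100 / 21)) * S) ^+ 2.
  rewrite ler_pXn2r ?nnegrE//; [lra|lra|].
  by apply: mulr_ge0; lra.
have e2 : (1 - S) * (2 * C ^+ 2 - 1 - S) <= (2 * (40 / 21 * (100 / 21)) * S) ^+ 2.
  have C2 : C ^+ 2 <= 153.
    by apply: (@le_trans _ _ ((617 / 50) ^+ 2)); [rewrite ler_pXn2r ?nnegrE//; lra|lra].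
  have C21 : 1 <= C ^+ 2 by rewrite exprn_ege1// (le_trans h_ge1).
  have : (1 - S) * (2 * C ^+ 2 - 1 - S) <= (71 / 200) * 305.
    by apply: ler_pM; lra.
  have : (117 / 10) ^+ 2 <= (2 * (40 / 21 * (100 / 21)) * S) ^+ 2.
    by rewrite ler_pXn2r ?nnegrE//; lra.
  by lra.
(* interpolate between the end points [h = 1] and [h = C] *)
have [C1|C1] := eqVneq C 1.
  have h1 : h = 1 by lra.
  by move: e1; rewrite h1 C1; lra.
have {}C1 : 0 < C - 1 by rewrite subr_gt0 lt_neqAle eq_sym C1 (le_trans h_ge1).
set B2 := (2 * (40 / 21 * (100 / 21)) * S) ^+ 2 in e1 e2.
have -> : (4 * (40 / 21 * (100 / 21)) * S) ^+ 2 = 4 * B2 by rewrite /B2; ring.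
rewrite ler_pM2l// -(ler_pM2r C1).
have i1 : (C - S) ^+ 2 * (C - h) <= B2 * (C - h) by rewrite ler_wpM2r// subr_ge0.
have i2 : (1 - S) * (2 * C ^+ 2 - 1 - S) * (h - 1) <= B2 * (h - 1).
  by rewrite ler_wpM2r// subr_ge0.
apply: (@le_trans _ _ ((C - S) ^+ 2 * (C - h) +
   (1 - S) * (2 * C ^+ 2 - 1 - S) * (h - 1))).
  rewrite -subr_ge0.
  have -> : (C - S) ^+ 2 * (C - h) + (1 - S) * (2 * C ^+ 2 - 1 - S) * (h - 1) -
      (C ^+ 2 + h ^+ 2 - 1 - 2 * S * C * h + S ^+ 2) * (C - 1) =
      (C - 1) * ((h - 1) * (C - h)) by ring.
  by rewrite mulr_ge0// ltW.
apply: le_trans (lerD i1 i2) _.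
by rewrite -mulrDr; have -> : C - h + (h - 1) = C - 1 by ring.
Qed.

End numerics.

(** * The estimates on the wronskian product *)

Section annulus_estimate.
Context {R : realType}.
Implicit Types (z w p : R[i]) (x y : R).

(** A logarithm of [z] whose imaginary part lies in the window of half width pi about a prescribed
    [a]. *)
Lemma expc_polar z (a : R) : z != 0 ->
  exists w, [/\ expc w = z, Re w = ln (normc z) & `|Im w - a| <= pi].
Proof.
move=> z0; have nz : 0 < normc z by rewrite normc_gt0.
pose v := z * expc (0 -i* a)%C / (normc z)%:C%C.
have nv : normc v = 1.
  rewrite /v !normcM normcV normc_real ger0_norm ?normc_ge0// normc_expc /=.
  by rewrite expR0 mulr1 divff// gt_eqF.
have Rv : -1 <= Re v <= 1 by rewrite -ler_norml -nv Re_le_normc.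
have Rv2 : Im v ^+ 2 = 1 - Re v ^+ 2.
  by have := sqr_normcE v; rewrite nv expr1n => ->; ring.
have main (phi : R) : `|phi| <= pi -> v = expc (0 +i* phi)%C ->
    exists w, [/\ expc w = z, Re w = ln (normc z) & `|Im w - a| <= pi].
  move=> phipi vE; exists (ln (normc z) +i* (a + phi))%C; split => //=; last first.
    by rewrite addrAC subrr add0r.
  have -> : (ln (normc z) +i* (a + phi))%C =
      (ln (normc z) +i* 0)%C + (0 +i* a)%C + (0 +i* phi)%C.
    by apply/eqP; rewrite eq_complex /= !addr0 !add0r !eqxx.
  rewrite !expcD -vE /v.
  have -> : expc (ln (normc z) +i* 0)%C = (normc z)%:C%C.
    by rewrite /expc /= cos0 sin0 mulr1 mulr0 lnK.
  have h1 : expc (0 +i* a)%C * expc (0 -i* a)%C = 1.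
    by rewrite -expcD -expc0; congr expc; apply/eqP; rewrite eq_complex /= addr0 subrr !eqxx.
  have n0 : (normc z)%:C%C != 0 by rewrite -normc_eq0 normc_real normr_eq0 gt_eqF.
  transitivity (z * (expc (0 +i* a)%C * expc (0 -i* a)%C) *
    ((normc z)%:C%C / (normc z)%:C%C)); first by ring.
  by rewrite h1 divff// !mulr1.
have [Iv|Iv] := leP 0 (Im v).
  apply: (main (acos (Re v))).
    by rewrite ger0_norm ?acos_ge0// acos_lepi.
  apply/eqP; rewrite eq_complex /expc /= expR0 !mul1r acosK ?eqxx//=.
  by rewrite sin_acos// -Rv2 sqrtr_sqr ger0_norm.
apply: (main (- acos (Re v))).
  by rewrite normrN ger0_norm ?acos_ge0// acos_lepi.
apply/eqP; rewrite eq_complex /expc /= expR0 !mul1r cosN acosK ?eqxx//=.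
by rewrite sinN sin_acos// -Rv2 sqrtr_sqr ltr0_norm// opprK.
Qed.

Let c : R := 21%:R / 100%:R.
Let k : R := pi / - ln c.

Lemma wronskian_product_le (f g : R[i] -> R[i]) p z :
  (forall z, normc z < 1 -> holo f z) -> (forall z, normc z < 1 -> holo g z) ->
  (forall z, c < normc z -> normc z < 1 -> normc (f z) <= normc (g z)) ->
  normc p ^+ 2 = c -> 0 < gap f g p -> 0 < gap f g (- p) ->
  3 / 10 <= normc z <= 7 / 10 ->
  normc (wronskian f g p z * wronskian f g (- p) z) <=
  40 / 21 * (100 / 21) * (Num.sqrt (gap f g p * gap f g (- p)) * gap f g z).
Proof.
move=> hf hg hfg npc gp gNp /andP[z3 z7].
have c0 : 0 < c by rewrite divr_gt0.
have c1 : c < 1 by rewrite /c; lra.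
have np0 : 0 < normc p.
  rewrite lt_def normc_ge0 andbT; apply/negP => /eqP h.
  by move: c0; rewrite -npc h expr0n/= ltxx.
have p0 : p != 0 by rewrite -normc_gt0.
have z0 : z != 0 by rewrite -normc_gt0; lra.
have [xp [pE Rp _]] := expc_polar 0 p0.
have [xz [zE Rz Iz]] := expc_polar (Im xp) z0.
have Rp2 : Re xp = ln c / 2 by rewrite -npc lnXn// Rp -mulr_natl; field.
have lnc0 : 0 < - ln c by rewrite oppr_gt0 ln_lt0// c0.
have k0 : 0 < k by rewrite divr_gt0// pi_gt0.
have strip_z : ln c < Re xz < 0.
  rewrite Rz ltr_ln ?posrE//; last by lra.
  by rewrite ln_lt0 ?andbT; rewrite /c; lra.
have S6 : 129 / 200 <= sin (k * - Re xz) by rewrite Rz; apply: sin_annulus_ge; rewrite z3.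
have S1 : sin (k * - Re xz) <= 1 by exact: sin_le1.
have negp (s : R) : cos s = -1 -> sin s = 0 -> expc (xp + (0 +i* s)%C) = - p.
  move=> cs ss; rewrite expcD pE /expc /= expR0 cs ss mul1r mulr0 -[RHS]mulrN1.
  by congr (_ * _); apply/eqP; rewrite eq_complex /= oppr0 !eqxx.
have gap_z : 0 <= gap f g z.
  rewrite subr_ge0 ler_pXn2r ?nnegrE ?normc_ge0//; apply: hfg; rewrite /c; lra.
have SP (x : R[i]) : Re x = ln c / 2 -> 0 < gap f g (expc x) ->
  normc (wronskian f g (expc x) z) ^+ 2 * (4 * sin (k * - Re xz)) <=
    (expR (k * (Im xz - Im x)) + expR (- (k * (Im xz - Im x))) -
      2 * sin (k * - Re xz)) * (gap f g z * gap f g (expc x)).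
  by move=> Rx gx; rewrite -zE; exact: (schwarz_pick_strip c0 c1 hf hg hfg Rx gx strip_z).
(* The sign of [s = pi] or [s = - pi] is chosen so that the logarithm of [z] lies, in height,
   between those of [p] and [- p]; the two scaled distances [a] and [b] then add up to [k * pi]. *)
have [a [b [s [a0 b0 ab]]]] : exists a b s : R, [/\ 0 <= a, 0 <= b, a + b = k * pi &
   [/\ expc (xp + (0 +i* s)%C) = - p,
    expR (k * (Im xz - Im xp)) + expR (- (k * (Im xz - Im xp))) =
      expR a + expR (- a) &
    expR (k * (Im xz - (Im xp + s))) + expR (- (k * (Im xz - (Im xp + s)))) =
      expR b + expR (- b)]].
  move: Iz; set t := Im xz - Im xp; rewrite ler_norml => /andP[t1 t2].
  have [t0|t0] := leP 0 t.
    exists (k * t), (k * (pi - t)), pi; split.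
    - by rewrite mulr_ge0// ltW.
    - by rewrite mulr_ge0 ?subr_ge0// ltW.
    - by ring.
    - rewrite negp ?cospi ?sinpi//; split => //.
      rewrite addrC; have -> : k * (Im xz - (Im xp + pi)) = - (k * (pi - t)).
        by rewrite /t; ring.
      by rewrite opprK.
  exists (- (k * t)), (k * (pi + t)), (- pi); split.
  - by rewrite -mulrN mulr_ge0 ?oppr_ge0// ltW.
  - by apply: mulr_ge0; [exact: ltW|lra].
  - by ring.
  - rewrite negp ?cosN ?sinN ?cospi ?sinpi ?oppr0//; split => //.
      by rewrite opprK addrC.
    have -> // : k * (Im xz - (Im xp - pi)) = k * (pi + t).
    by rewrite /t; ring.
move=> [Np Ea Eb].
have h1 := SP _ Rp2; rewrite pE Ea in h1; have {}h1 := h1 gp.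
have Rp3 : Re (xp + (0 +i* s)%C) = ln c / 2 by rewrite ReD /= addr0.
have h2 := SP _ Rp3; rewrite Np ImD /= Eb in h2; have {}h2 := h2 gNp.
have PB := product_bound a0 b0 ab S6 S1.
set S := sin _ in S6 S1 h1 h2 PB.
set W1 := wronskian f g p z in h1 *; set W2 := wronskian f g (- p) z in h2 *.
set G := gap f g z in gap_z h1 h2 *.
set G1 := gap f g p in gp h1 *; set G2 := gap f g (- p) in gNp h2 *.
set E1 := _ - 2 * S in h1 PB; set E2 := _ - 2 * S in h2 PB.
have S0 : 0 < S by lra.
have n1 : 0 <= normc W1 ^+ 2 * (4 * S) by rewrite mulr_ge0 ?sqr_ge0// mulr_ge0// ltW.
have n2 : 0 <= normc W2 ^+ 2 * (4 * S) by rewrite mulr_ge0 ?sqr_ge0// mulr_ge0// ltW.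
set N := 40 / 21 * (100 / 21) in PB *.
have N0 : 0 <= N by rewrite /N; lra.
rewrite -(ler_pXn2r (n := 2)) ?nnegrE ?normc_ge0 ?mulr_ge0 ?sqrtr_ge0//.
have G12 : 0 <= G1 * G2 by apply: mulr_ge0; exact: ltW.
have -> : (N * (Num.sqrt (G1 * G2) * G)) ^+ 2 = N ^+ 2 * (G1 * G2 * G ^+ 2).
  by rewrite -{2}(sqr_sqrtr G12); ring.
rewrite normcM exprMn.
have S2 : 0 < (4 * S) ^+ 2 by rewrite exprn_gt0// mulr_gt0.
rewrite -(ler_pM2r S2).
have -> : normc W1 ^+ 2 * normc W2 ^+ 2 * (4 * S) ^+ 2 =
  (normc W1 ^+ 2 * (4 * S)) * (normc W2 ^+ 2 * (4 * S)) by ring.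
apply: le_trans (ler_pM n1 n2 h1 h2) _.
have -> : E1 * (G * G1) * (E2 * (G * G2)) = E1 * E2 * (G ^+ 2 * (G1 * G2)) by ring.
have -> : N ^+ 2 * (G1 * G2 * G ^+ 2) * (4 * S) ^+ 2 =
  (4 * N * S) ^+ 2 * (G ^+ 2 * (G1 * G2)) by ring.
by rewrite ler_wpM2r// mulr_ge0 ?sqr_ge0// mulr_ge0// ltW.
Qed.

(* If [gap f g z < 0], then [sqr_polar] gives
   [- gap f g z * gap f g p <= normc (wronskian f g p z) ^+ 2], and likewise for [- p]. *)
Lemma gap_le_wronskian (f g : R[i] -> R[i]) p z :
  0 < gap f g p -> 0 < gap f g (- p) ->
  - gap f g z * Num.sqrt (gap f g p * gap f g (- p)) <=
  normc (wronskian f g p z * wronskian f g (- p) z).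
Proof.
move=> gp gNp; have [gz|gz] := leP 0 (gap f g z).
  apply: le_trans (normc_ge0 _).
  by rewrite mulNr oppr_le0 mulr_ge0 ?sqrtr_ge0.
have h p' : 0 < gap f g p' ->
    - gap f g z * gap f g p' <= normc (wronskian f g p' z) ^+ 2.
  move=> gp'; have := sqr_polar f g p' z; have := sqr_ge0 (normc (polar f g p' z)).
  by move=> ? ?; rewrite mulNr; lra.
have gz' : 0 <= - gap f g z by rewrite oppr_ge0 ltW.
rewrite -(ler_pXn2r (n := 2)) ?nnegrE ?normc_ge0 ?mulr_ge0 ?sqrtr_ge0//.
have G12 : 0 <= gap f g p * gap f g (- p) by apply: mulr_ge0; exact: ltW.
rewrite normcM !exprMn sqr_sqrtr//.
have -> : (- gap f g z) ^+ 2 * (gap f g p * gap f g (- p)) =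
  (- gap f g z * gap f g p) * (- gap f g z * gap f g (- p)) by ring.
by apply: ler_pM; rewrite ?h//; apply: mulr_ge0 => //; exact: ltW.
Qed.

End annulus_estimate.

(** * Area integrals over discs *)

Section change_of_variables.
Context {R : realType}.
Local Notation mu := (@lebesgue_measure R).
Local Notation mu2 := ((@lebesgue_measure R \x @lebesgue_measure R)%E).
Implicit Types (a b x y : R).
Local Open Scope ereal_scope.

Lemma measurable_affine a b :
  @measurable_fun _ _ (measurableTypeR R) (measurableTypeR R) setT
    (fun x => a * x + b)%R.
Proof. by apply: measurable_funD => //; exact: measurable_funM. Qed.

Let image_measure a b : {measure set (measurableTypeR R) -> \bar R} :=
  measure_function_pushforward__canonical__measure_function_Measure
    mu (measurable_affine a b).

(** By uniqueness of Lebesgue measure it is enough to compare half-open intervals. *)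
Let lebesgue_affine a b (a0 : (0 < a)%R) (A : set (measurableTypeR R)) :
  measurable A -> mu A = mscale (NngNum (ltW a0)) (image_measure a b) A.
Proof.
apply: lebesgue_measure_unique => X /ocitvP[->|[[u v] /= uv ->]].
  by rewrite !measure0.
rewrite /mscale /image_measure /= /pushforward.
have -> : (fun x : R => (a * x + b)%R) @^-1` `]u, v]%classic =
    `]((u - b) / a)%R, ((v - b) / a)%R]%classic.
  apply/seteqP; split => x /=; rewrite !in_itv/= => /andP[h1 h2].
    by rewrite ltr_pdivrMr// ler_pdivlMr// mulrC ltrBlDr h1 lerBrDr.
  by move: h1 h2; rewrite ltr_pdivrMr// ler_pdivlMr// mulrC ltrBlDr lerBrDr => -> ->.
rewrite !lebesgue_measure_itv/= !lte_fin uv ltr_pM2r ?invr_gt0// ltrD2r uv.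
by rewrite -!EFinB -EFinM; congr EFin; field; rewrite gt_eqF.
Qed.

Lemma integral_affine a b (phi : R -> \bar R) : (0 < a)%R ->
  measurable_fun [set: measurableTypeR R] phi -> (forall x, 0 <= phi x) ->
  \int[mu]_x phi x = a%:E * \int[mu]_x phi (a * x + b)%R.
Proof.
move=> a0 mphi phi0.
have -> : \int[mu]_x phi x = \int[mscale (NngNum (ltW a0)) (image_measure a b)]_x phi x.
  by apply: eq_measure_integral => A mA _; exact: lebesgue_affine.
rewrite ge0_integral_mscale//; congr (_ * _).
by rewrite ge0_integral_pushforward//; exact: measurable_affine.
Qed.

Let T2 : measurableType _ := (measurableTypeR R * measurableTypeR R)%type.

Let measurable_linear1 (a b : R) :
  @measurable_fun _ _ T2 (measurableTypeR R) setT (fun p => a * p.1 + b * p.2)%R.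
Proof.
by apply: measurable_funD; apply: measurable_funM.
Qed.

Lemma measurable_linear (a b c d : R) : @measurable_fun _ _ T2 T2 setT
  (fun p => (a * p.1 + b * p.2, c * p.1 + d * p.2)%R).
Proof. by apply: measurable_fun_pair; exact: measurable_linear1. Qed.

Let tonelli1 (psi : R * R -> \bar R) : @measurable_fun _ _ T2 _ setT psi ->
  (forall p, 0 <= psi p) ->
  \int[mu2]_p psi p = \int[mu]_x \int[mu]_y psi (x, y).
Proof. exact: (@fubini_tonelli1 _ _ (measurableTypeR R) (measurableTypeR R) _ mu mu). Qed.

Let tonelli2 (psi : R * R -> \bar R) : @measurable_fun _ _ T2 _ setT psi ->
  (forall p, 0 <= psi p) ->
  \int[mu2]_p psi p = \int[mu]_y \int[mu]_x psi (x, y).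
Proof. exact: (@fubini_tonelli2 _ _ (measurableTypeR R) (measurableTypeR R) _ mu mu). Qed.

Variable phi : R * R -> \bar R.
Hypothesis mphi : @measurable_fun _ _ T2 _ setT phi.
Hypothesis phi0 : forall p, 0 <= phi p.

Let mcomp (h : R * R -> R * R) : @measurable_fun _ _ T2 T2 setT h ->
  @measurable_fun _ _ T2 _ setT (fun p => phi (h p)).
Proof. by move=> mh; exact: (measurableT_comp mphi mh). Qed.

(** Tonelli reduces a shear to a translation in one variable. The coefficients 0 and 1 are kept to
    match [measurable_linear]. *)
Lemma integral_shear1 t :
  \int[mu2]_p phi (1 * p.1 + t * p.2, 0 * p.1 + 1 * p.2)%R = \int[mu2]_p phi p.
Proof.
rewrite (tonelli2 (mcomp (measurable_linear _ _ _ _)) (fun p => phi0 _)).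
rewrite (tonelli2 mphi phi0); apply: eq_integral => y _ /=.
have my : measurable_fun [set: measurableTypeR R] (fun x => phi (x, y)).
  exact: (measurable_fun_pair1 _ mphi).
rewrite [RHS](integral_affine (t * y)%R ltr01 my)// mul1e.
by apply: eq_integral => x _; rewrite mul0r add0r !mul1r.
Qed.

Lemma integral_shear2 t :
  \int[mu2]_p phi (1 * p.1 + 0 * p.2, t * p.1 + 1 * p.2)%R = \int[mu2]_p phi p.
Proof.
rewrite (tonelli1 (mcomp (measurable_linear _ _ _ _)) (fun p => phi0 _)).
rewrite (tonelli1 mphi phi0); apply: eq_integral => x _ /=.
have mx : measurable_fun [set: measurableTypeR R] (fun y => phi (x, y)).
  exact: (measurable_fun_pair2 _ mphi).
rewrite [RHS](integral_affine (t * x)%R ltr01 mx)// mul1e.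
by apply: eq_integral => y _; rewrite mul0r addr0 !mul1r addrC.
Qed.

Lemma integral_dilation r : (0 < r)%R ->
  \int[mu2]_p phi p = (r ^+ 2)%:E * \int[mu2]_p phi (r * p.1 + 0 * p.2, 0 * p.1 + r * p.2)%R.
Proof.
move=> r0.
have mr := mcomp (measurable_linear r 0 0 r).
rewrite (tonelli1 mr (fun p => phi0 _)) (tonelli1 mphi phi0).
have mF := @measurable_fun_fubini_tonelli_F _ _ (measurableTypeR R)
  (measurableTypeR R) _ mu _ mphi phi0.
have F0 x : 0 <= \int[mu]_y phi (x, y) by apply: integral_ge0 => y _; exact: phi0.
rewrite (integral_affine 0 r0 mF F0) expr2 EFinM -muleA; congr (_ * _).
rewrite -ge0_integralZl_EFin ?ltW//.
- apply: eq_integral => x _; rewrite /fubini_F /=.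
  have mx : measurable_fun [set: measurableTypeR R] (fun y => phi (r * x + 0, y)%R).
    exact: (measurable_fun_pair2 _ mphi).
  rewrite [LHS](integral_affine 0 r0 mx)//; congr (_ * _).
  by apply: eq_integral => y _; rewrite !mul0r add0r !addr0.
- by move=> x _; apply: integral_ge0 => y _; exact: phi0.
- exact: (@measurable_fun_fubini_tonelli_F _ _ (measurableTypeR R)
    (measurableTypeR R) _ mu _ mr (fun p => phi0 _)).
Qed.

End change_of_variables.

Section rotation.
Context {R : realType}.
Local Notation mu2 := ((@lebesgue_measure R \x @lebesgue_measure R)%E).
Let T2 : measurableType _ := (measurableTypeR R * measurableTypeR R)%type.
Local Open Scope ereal_scope.

(* A rotation is a product of three shears. *)
Lemma integral_rotation (a b : R) (phi : R * R -> \bar R) :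
  (a ^+ 2 + b ^+ 2 = 1)%R -> a != (- 1)%R ->
  @measurable_fun _ _ T2 _ setT phi -> (forall p, 0 <= phi p) ->
  \int[mu2]_p phi (a * p.1 + - b * p.2, b * p.1 + a * p.2)%R = \int[mu2]_p phi p.
Proof.
(* For [a = cos theta] and [b = sin theta] this is [- tan (theta / 2)], whence the exclusion of
   [a = -1]. *)
move=> ab a1 mphi phi0; pose t := (- b / (1 + a))%R.
have a10 : (1 + a != 0)%R by rewrite addrC -[1%R]opprK subr_eq0.
have ta : (t * (1 + a) = - b)%R by rewrite /t divfK.
have tb : (1 + b * t = a)%R.
  apply: (mulIf a10).
  have -> : ((1 + b * t) * (1 + a) = 1 + a + b * (t * (1 + a)))%R by ring.
  have b2 : (b ^+ 2 = 1 - a ^+ 2)%R by rewrite -ab; ring.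
  by rewrite ta mulrN -expr2 b2; ring.
pose phi1 p := phi (1 * p.1 + t * p.2, 0 * p.1 + 1 * p.2)%R.
have mphi1 : @measurable_fun _ _ T2 _ setT phi1.
  exact: (measurableT_comp mphi (measurable_linear _ _ _ _)).
pose phi2 p := phi1 (1 * p.1 + 0 * p.2, b * p.1 + 1 * p.2)%R.
have mphi2 : @measurable_fun _ _ T2 _ setT phi2.
  exact: (measurableT_comp mphi1 (measurable_linear _ _ _ _)).
rewrite -(integral_shear1 mphi phi0 t) -/phi1.
rewrite -[RHS](integral_shear2 mphi1 (fun p => phi0 _) b).
rewrite -[RHS](integral_shear1 mphi2 (fun p => phi0 _) t).
apply: eq_integral => -[x y] _; rewrite /phi2 /phi1 /=; congr phi.
have -> : (- b = t * (1 + a))%R by rewrite ta.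
have -> : (b * x + a * y = b * x + (1 + b * t) * y)%R by rewrite tb.
have -> : (a * x + t * (1 + a) * y = (1 + b * t) * x + t * (1 + a) * y)%R by rewrite tb.
by rewrite -tb; congr pair; ring.
Qed.

End rotation.

(** * Discrete circular means *)

Section rotation_mean.
Context {R : realType}.
Implicit Types (z w u : R[i]) (x y e r rho : R).

(** Heine-Cantor, with [w] allowed to leave [K]; the radius [d] tending to 0 is the parameter of the
    near-covering form of compactness. *)
Lemma ccompact_uniform (K : set R[i]) (f : R[i] -> R[i]) e : ccompact K ->
  (forall z, K z -> ccont f z) -> 0 < e ->
  exists2 d, 0 < d & forall z w, K z -> normc (w - z) < d ->
    normc (f w - f z) < e.
Proof.
move=> cK cf e0.
have := (compact_near_coveringP _).1 cK R (0^'+)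
  (fun (d : R) (p : R * R) => forall w, normc (w - (p.1 +i* p.2)%C) < d ->
     normc (f w - f (p.1 +i* p.2)%C) < e) _.
case=> [p Kp|d /= d0 H].
  have e20 : 0 < e / 2 by rewrite divr_gt0.
  have [r r0 Hr] := cf _ Kp _ e20.
  have r20 : 0 < r / 2 by rewrite divr_gt0.
  have r40 : 0 < r / 2 / 2 by rewrite divr_gt0.
  exists (ball p (r / 2 / 2), [set d | d < r / 2]).
    split; first exact: nbhsx_ballx.
    exact: nbhs_right_lt.
  move=> [q d] /= [[q1 q2] dr] w wq.
  have qp : normc ((q.1 +i* q.2)%C - (p.1 +i* p.2)%C) < r / 2.
    apply: le_lt_trans (normc_le_ReIm _) _; rewrite !ReImE /= (splitr (r / 2)).
    by rewrite ltrD// distrC.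
  have h1 : normc (f (q.1 +i* q.2)%C - f (p.1 +i* p.2)%C) < e / 2.
    by apply: Hr; rewrite (lt_trans qp)// gtr_pMr// invf_lt1// ltr1n.
  have h2 : normc (f w - f (p.1 +i* p.2)%C) < e / 2.
    apply: Hr; rewrite -(subrKA (q.1 +i* q.2)%C) (splitr r).
    by rewrite (le_lt_trans (le_normcD _ _))// ltrD// (lt_trans wq).
  rewrite -(subrKA (f (p.1 +i* p.2)%C)) (splitr e).
  by rewrite (le_lt_trans (le_normcD _ _))// ltrD// normcBC.
have d20 : 0 < d / 2 by rewrite divr_gt0.
exists (d / 2) => // z w Kz wz.
have dd : ball (0 : R) d (d / 2).
  by rewrite /ball/= sub0r normrN gtr0_norm// gtr_pMr// invf_lt1// ltr1n.
have := H _ dd d20 (Re z, Im z); rewrite /= complexK.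
by move=> /(_ Kz w wz).
Qed.

(** A chord is at most its arc: [|exp(i s) - 1|^2 = 2 - 2 cos s <= s^2]. *)
Lemma expc_imag_dist x y :
  normc (expc (0 +i* x)%C - expc (0 +i* y)%C) <= `|x - y|.
Proof.
have -> : expc (0 +i* x)%C - expc (0 +i* y)%C =
    expc (0 +i* y)%C * (expc (0 +i* (x - y))%C - 1).
  rewrite mulrBr mulr1 -expcD; congr (expc _ - _).
  by apply/eqP; rewrite eq_complex /= addr0 eqxx/= subrKC.
rewrite normcM normc_expc (_ : Re (0 +i* y)%C = 0)// expR0 mul1r.
set s := x - y.
rewrite -(ler_pXn2r (n := 2)) ?nnegrE ?normc_ge0// sqr_normcE !ReImE /=.
rewrite expR0 !mul1r subr0 -normrX ger0_norm ?sqr_ge0//.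
have h : 1 - s ^+ 2 / 2 <= cos s.
  by have := cos_ge_taylor2 (normr_ge0 s); rewrite cos_norm real_normK ?num_real.
have := cos2Dsin2 s; have -> : (cos s - 1) ^+ 2 + sin s ^+ 2 =
  cos s ^+ 2 + sin s ^+ 2 + 1 - 2 * cos s by ring.
by move=> ->; lra.
Qed.

Lemma sum_periodic_shift (F : nat -> R) (n k : nat) :
  (forall j, F (j + n)%N = F j) -> \sum_(j < n) F (k + j)%N = \sum_(j < n) F j.
Proof.
move=> per; elim: k => [|k <-]; first by apply: eq_bigr => j _; rewrite add0n.
case: n per => [|n] per; first by rewrite !big_ord0.
rewrite big_ord_recr [RHS]big_ord_recl /= addn0 [RHS]addrC.
congr (_ + _); last by rewrite addSnnS per.
by apply: eq_bigr => j _; rewrite /bump /= addnA addn1 addSn.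
Qed.

Section mean.
Variables (E : R[i] -> R[i]) (r e d : R).
Hypotheses (r0 : 0 < r) (r1 : r < 1).
Hypothesis hE : forall z, normc z < 1 -> holo E z.
Hypothesis Eunif : forall z w, normc z <= r -> normc (w - z) < d ->
  normc (E w - E z) < e.
Variable n : nat.
Hypotheses (n0 : (0 < n)%N) (nd : 2 * pi / n%:R < d).

Definition root_angle (j : nat) : R := j%:R * (2 * pi / n%:R).
Let l (j : nat) : R[i] := expc (0 +i* root_angle j)%C.

Let nl j : normc (l j) = 1.
Proof. by rewrite normc_expc /= expR0. Qed.

Let lD j k : l (j + k) = l j * l k.
Proof.
rewrite /l -expcD; congr expc; apply/eqP; rewrite eq_complex /= addr0 eqxx/=.
by rewrite /root_angle natrD mulrDl.
Qed.

Let ln : l n = 1.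
Proof.
rewrite /l /root_angle mulrC divfK ?pnatr_eq0 -?lt0n//.
by rewrite -expc0 mulr_natl -expc_2pi.
Qed.

Let nearest_root z : normc z = 1 -> exists k, normc (z - l k) < d.
Proof.
move=> z1; have z0 : z != 0 by rewrite -normc_gt0 z1.
have [w [wz Rw Iw']] := expc_polar pi z0; rewrite z1 ln1 in Rw.
move: Iw'; rewrite -wz ler_norml => /andP[w1 w2].
have wE : w = (0 +i* Im w)%C by rewrite -[w in LHS]complexK Rw.
pose t : R := 2 * pi / n%:R.
have pi0 := @pi_gt0 R.
have t0 : 0 < t by rewrite divr_gt0 ?mulr_gt0// ltr0n.
have Iw : 0 <= Im w / t by apply: divr_ge0; [lra|exact: ltW].
exists (Num.truncn (Im w / t)); rewrite wE; apply: le_lt_trans (expc_imag_dist _ _) _.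
have /andP[] := truncn_itv Iw; rewrite ler_pdivlMr// ltr_pdivrMr//.
rewrite -/t; rewrite /root_angle -/t -natr1 mulrDl mul1r => h1 h2.
apply: le_lt_trans nd; rewrite -/t ger0_norm ?subr_ge0//.
by rewrite lerBlDr addrC ltW.
Qed.

(** A finite sum over roots of unity replaces the circular mean. The error [n * e] accounts for the
    points of the circle [|z| = r] between consecutive roots. *)
Lemma rotation_mean_le rho u : 0 <= rho -> rho <= r -> normc u <= 1 ->
  \sum_(j < n) normc (E (rho%:C%C * (l j * u))) <=
  \sum_(j < n) normc (E (r%:C%C * (l j * u))) + n%:R * e.
Proof.
move=> rho0 rhor u1.
(* Phases that make every term of [H rho] nonnegative; where [E] vanishes the convention for
   division by 0 gives the harmless value 0. *)
pose c (j : nat) := (E (rho%:C%C * (l j * u)))^*%C / (normc (E (rho%:C%C * (l j * u))))%:C%C.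
pose H z := \sum_(j < n) c j * E (z * (l j * u)).
set M := _ + n%:R * e.
have nz z j : normc (z * (l j * u)) = normc z * normc u by rewrite !normcM nl mul1r.
have zr z j : normc z <= r -> normc (z * (l j * u)) <= r.
  move=> z1; rewrite nz; apply: le_trans z1.
  by rewrite ler_piMr// normc_ge0.
have nc j : normc (c j) <= 1.
  rewrite /c normcM normcV normc_conjc normc_real ger0_norm ?normc_ge0//.
  have [->|h] := eqVneq (normc (E (rho%:C%C * (l j * u)))) 0; first by rewrite mul0r.
  by rewrite divff.
have holoH z : normc z <= r -> holo H z.
  move=> z1; apply: (@holo_sum R _ _ (fun (j : 'I_n) z => c j * E (z * (l j * u)))) => j.
  apply: holoM; first exact: holo_cst.
  apply: (@holo_comp R (fun z => z * (l j * u)) E).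
    by apply: holoM; [exact: holo_id|exact: holo_cst].
  by apply: hE; rewrite (le_lt_trans (zr _ _ z1)).
have Hrho : normc (H rho%:C%C) = \sum_(j < n) normc (E (rho%:C%C * (l j * u))).
  have -> : H rho%:C%C = (\sum_(j < n) normc (E (rho%:C%C * (l j * u))))%:C%C.
    rewrite rmorph_sum; apply: eq_bigr => j _; rewrite /c.
    set v := E _; have [->|v0] := eqVneq v 0; first by rewrite mulr0 normc0.
    have nv0 : (normc v)%:C%C != 0 by rewrite -normc_eq0 normc_real normr_eq0 normc_eq0.
    apply: (mulIf nv0); rewrite mulrAC divfK// -rmorphM -expr2 sqr_normcE.
    by case: v {v0 nv0} => a b; apply/eqP; rewrite eq_complex /=; apply/andP; split; apply/eqP; ring.
  by rewrite normc_real ger0_norm// sumr_ge0// => j _; exact: normc_ge0.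
have M0 : 0 <= M.
  rewrite addr_ge0 ?sumr_ge0// ?mulr_ge0//.
    by move=> j _; exact: normc_ge0.
  have z00 : normc (0 : R[i]) <= r by rewrite normc0 ltW.
  have dd : 0 < d by rewrite (le_lt_trans _ nd)// divr_ge0// mulr_ge0// pi_ge0.
  have := Eunif z00 (_ : normc (0 - 0) < d); rewrite !subrr !normc0.
  by move=> /(_ dd) /ltW.
rewrite -Hrho; apply: (@maximum_modulus_disc R H 0 r M) => //.
- by move=> z; rewrite subr0 => /holoH/holo_ccont.
- by move=> z; rewrite subr0 => /holoH.
- move=> z; rewrite subr0 => zr1.
  pose zeta := z / r%:C%C.
  have rC0 : r%:C%C != 0 by rewrite -normc_eq0 normc_real normr_eq0 gt_eqF.
  have zE : z = r%:C%C * zeta by rewrite /zeta mulrC divfK.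
  have /nearest_root[k kd] : normc zeta = 1.
    by rewrite /zeta normcM normcV normc_real zr1 gtr0_norm// divff// gt_eqF.
  apply: le_trans (normc_sum _ _) _.
  (* Replacing [zeta] by the nearby root [l k] costs at most [e] per term and merely shifts the
     index, which leaves the periodic sum unchanged. *)
  apply: (@le_trans _ _ (\sum_(j < n) (normc (E (r%:C%C * (l (k + j)%N * u))) + e))).
    apply: ler_sum => j _; rewrite normcM.
    apply: (@le_trans _ _ (normc (E (z * (l j * u))))).
      by rewrite ler_piMl ?normc_ge0.
    apply: le_trans (normc_le_dist _ (E (r%:C%C * (l (k + j)%N * u)))) _.
    rewrite lerD2l ltW//; apply: Eunif.
      rewrite !normcM nl mul1r normc_real gtr0_norm//.
      by rewrite ler_piMr// ltW.
    have -> : z * (l j * u) - r%:C%C * (l (k + j)%N * u) =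
        (r%:C%C * (l j * u)) * (zeta - l k).
      by rewrite zE lD; ring.
    rewrite normcM; apply: le_lt_trans kd; rewrite ler_piMl ?normc_ge0//.
    rewrite !normcM nl mul1r normc_real gtr0_norm//.
    by rewrite mulr_ile1 ?normc_ge0// ltW.
  rewrite big_split /= sumr_const card_ord /M mulr_natl lerD2r.
  rewrite (@sum_periodic_shift (fun j => normc (E (r%:C%C * (l j * u)))))//.
  by move=> j; rewrite lD ln mulr1.
by rewrite subr0 normc_real ger0_norm.
Qed.

End mean.
End rotation_mean.

(** * Measurability in the plane and means over discs *)

Section plane_measurability.
Context {R : realType}.
Local Notation mu := (@lebesgue_measure R).
Local Notation mu2 := ((@lebesgue_measure R \x @lebesgue_measure R)%E).
Local Notation T2 := (measurableTypeR R * measurableTypeR R)%type.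
Implicit Types (p q : R * R) (z w : R[i]) (r x y : R).

Definition pt p : R[i] := (p.1 +i* p.2)%C.

Definition plane_open (A : set R[i]) :=
  forall z, A z -> exists2 r : R, 0 < r & forall w, normc (w - z) < r -> A w.

(** An open set is the countable union of the rational boxes that it contains. *)
Lemma plane_open_measurable (A : set R[i]) : plane_open A ->
  measurable ([set p | A (pt p)] : set T2).
Proof.
move=> oA.
pose box (i : rat * rat * rat * rat) : set T2 :=
  let: (a, b, c, d) := i in
  (`]ratr a, ratr b[%classic : set (measurableTypeR R)) `*`
  (`]ratr c, ratr d[%classic : set (measurableTypeR R)).
pose U i := if pselect (box i `<=` [set p | A (pt p)]) then box i else set0.
have -> : [set p | A (pt p)] = \bigcup_i U i.
  apply/seteqP; split => p; last first.
    by move=> [i _]; rewrite /U; case: pselect => // H /H.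
  move=> Ap; have [r r0 Hr] := oA _ Ap.
  have r20 : 0 < r / 2 by rewrite divr_gt0.
  have lt1 (x : R) : x - r / 2 < x by rewrite ltrBlDr ltrDl.
  have lt2 (x : R) : x < x + r / 2 by rewrite ltrDl.
  have [a ha] := rat_in_itvoo (lt1 p.1); have [b hb] := rat_in_itvoo (lt2 p.1).
  have [c hc] := rat_in_itvoo (lt1 p.2); have [d hd] := rat_in_itvoo (lt2 p.2).
  move: ha hb hc hd; rewrite !in_itv/=.
  move=> /andP[a1 a2] /andP[b1 b2] /andP[c1 c2] /andP[d1 d2].
  exists (a, b, c, d) => //; rewrite /U; case: pselect => [?|[]].
    by split; rewrite /= in_itv/= ?a2 ?b1 ?c2 ?d1.
  move=> q [] /=; rewrite !in_itv/= => /andP[q1 q2] /andP[q3 q4].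
  apply: Hr; apply: le_lt_trans (normc_le_ReIm _) _; rewrite !ReImE /=.
  by rewrite (splitr r) ltrD// ltr_norml; apply/andP; split; lra.
have mbox i : measurable (box i).
  by case: i => [[[a b] c] d]; apply: measurableX; exact: measurable_itv.
apply: countable_bigcupT_measurable; first exact: countableP.
by move=> i; rewrite /U; case: pselect => ?; [exact: mbox|exact: measurable0].
Qed.

Lemma measurable_normc (A : set R[i]) (f : R[i] -> R[i]) : plane_open A ->
  (forall z, A z -> ccont f z) ->
  @measurable_fun _ _ T2 (measurableTypeR R) [set p | A (pt p)]
    (fun p => normc (f (pt p))).
Proof.
move=> oA cf; apply: (measurability _ (RGenOInfty.measurableE R)).
move=> _ [_ [x ->] <-].
have -> : [set p | A (pt p)] `&` (fun p => normc (f (pt p))) @^-1` `]x, +oo[ =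
    [set p | (A `&` [set z | x < normc (f z)]) (pt p)].
  by apply/seteqP; split => p /=; rewrite in_itv/= andbT.
apply: plane_open_measurable => z [Az /= xz].
have [r r0 Hr] := oA _ Az.
have e0 : 0 < normc (f z) - x by rewrite subr_gt0.
have [s s0 Hs] := ccont_normc (cf _ Az) e0.
exists (Num.min r s); first by rewrite lt_min r0.
move=> w; rewrite lt_min => /andP[/Hr Aw /Hs]; rewrite ltr_norml => /andP[h _].
by split => //=; lra.
Qed.

Lemma plane_openT : plane_open [set: R[i]].
Proof. by move=> z _; exists 1. Qed.

Lemma plane_open_disc r : plane_open [set z : R[i] | normc z < r].
Proof.
move=> z /=; rewrite -[z in normc z]subr0 => /disc_nbhs[d d0 H].
by exists d => // w /H; rewrite subr0.
Qed.

Definition disc r : set (R * R) := [set p | normc (pt p) <= r].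

Lemma mem_disc r p : (p \in disc r) = (normc (pt p) <= r).
Proof. by apply/idP/idP; rewrite inE. Qed.

Lemma measurable_disc r : measurable (disc r : set T2).
Proof.
have := measurable_normc plane_openT (fun z _ => holo_ccont (holo_id z)).
have -> : [set p | [set: R[i]] (pt p)] = setT by apply/seteqP; split.
move=> /(_ measurableT `]-oo, r]%classic (measurable_itv _)).
rewrite setTI; congr measurable; apply/seteqP; split => p /=;
by rewrite in_itv/=.
Qed.

Lemma measurable_open_disc r : measurable ([set p | normc (pt p) < r] : set T2).
Proof. exact: (plane_open_measurable (@plane_open_disc r)). Qed.

Lemma mu2_disc_le : (mu2 (disc 1) <= 4%:E)%E.
Proof.
pose I : set (measurableTypeR R) := `[(- 1 : R), 1]%classic.
have mI : measurable I by exact: measurable_itv.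
apply: (@le_trans _ _ (mu2 (I `*` I))).
  apply: le_measure; rewrite ?inE.
  - exact: measurable_disc.
  - exact: measurableX.
  - move=> p /= pd; have := le_trans (Re_le_normc _) pd.
    have := le_trans (Im_le_normc _) pd; rewrite !ler_norml /= => h1 h2.
    by split; rewrite /I /= in_itv/=.
have muI : mu I = 2%:E.
  have -> : mu I = ((1 : R)%:E - (- 1 : R)%:E)%E.
    have h : - 1 < 1 :> R by lra.
    by rewrite /I (lebesgue_measure_itv `[(- 1 : R), 1]) /= lte_fin h.
  by rewrite -EFinB opprK.
have -> : mu2 (I `*` I) = (mu I * mu I)%E by exact: product_measure1E.
by rewrite muI -EFinM lee_fin; lra.
Qed.

Section disc_means.
Variable E : R[i] -> R[i].
Hypothesis hE : forall z, normc z < 1 -> holo E z.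

(** All discs are rescaled to the unit disc, so that means at different radii become integrals over
    one domain and can be compared pointwise. *)
Let dilate (l : R[i]) : R * R -> \bar R :=
  (fun p => (normc (E (l * pt p)))%:E) \_ (disc 1).

Let dilateE l p : dilate l p = if normc (pt p) <= 1 then (normc (E (l * pt p)))%:E else 0%E.
Proof.
rewrite /dilate patchE; case: ifPn; first by rewrite inE => /= ->.
by rewrite notin_setE /= => /negP/negbTE ->.
Qed.

Let dilate_ge0 l p : (0 <= dilate l p)%E.
Proof. by rewrite dilateE; case: ifP => // _; rewrite lee_fin normc_ge0. Qed.

Let measurable_dilate l : normc l < 1 ->
  @measurable_fun _ _ T2 _ setT (dilate l).
Proof.
move=> l1; apply/(@measurable_restrictT _ _ T2 _ (disc 1)).
  exact: (@measurable_disc 1).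
apply/measurable_EFinP.
pose A := [set z : R[i] | normc (l * z) < 1].
have oA : plane_open A.
  move=> z /= lz; have [d d0 H] := plane_open_disc lz.
  exists d => // w wz; apply: H; rewrite -mulrBr normcM.
  by rewrite (le_lt_trans _ wz)// ler_piMl ?normc_ge0// ltW.
have cA z : A z -> ccont (fun z => E (l * z)) z.
  move=> Az; apply: holo_ccont; apply: (@holo_comp R (fun z => l * z) E).
    by apply: holoM; [exact: holo_cst|exact: holo_id].
  exact: hE.
apply: measurable_funS (measurable_normc oA cA).
  exact: plane_open_measurable.
move=> p /= p1; rewrite /A /= normcM; apply: le_lt_trans l1.
by rewrite ler_piMr ?normc_ge0.
Qed.

Let J (l : R[i]) : \bar R := (\int[mu2]_p dilate l p)%E.

Let J_rotate l (s : R) : cos s != -1 -> normc l < 1 ->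
  J (l * expc (0 +i* s)%C) = J l.
Proof.
move=> cs l1.
have s1 : cos s ^+ 2 + sin s ^+ 2 = 1 by exact: cos2Dsin2.
rewrite /J -(integral_rotation s1 cs (measurable_dilate l1) (dilate_ge0 l)).
apply: eq_integral => p _; rewrite !dilateE.
have -> : pt (cos s * p.1 + - sin s * p.2, sin s * p.1 + cos s * p.2) =
    expc (0 +i* s)%C * pt p.
  apply/eqP; rewrite eq_complex /expc /pt /= expR0.
  by apply/andP; split; apply/eqP; ring.
by rewrite normcM normc_expc /= expR0 mul1r mulrA.
Qed.

(** Reached by [j] small rotations, none of them by the angle pi that the shear decomposition
    excludes. *)
Let J_root l n j : normc l < 1 -> 2 * pi / n%:R < 1 :> R ->
  J (l * expc (0 +i* root_angle n j)%C) = J l.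
Proof.
move=> l1 n1.
have t0 : 0 <= 2 * pi / n%:R :> R by rewrite divr_ge0// mulr_ge0// pi_ge0.
have ct : cos (2 * pi / n%:R) != -1 :> R.
  have := cos_ge_taylor2 t0; set t := _ / _ in n1 t0 * => h.
  have t2 : t ^+ 2 <= 1 by rewrite expr_le1// ltW.
  by apply/eqP => h2; lra.
elim: j => [|j IH].
  rewrite /root_angle mul0r; have -> : (0 +i* 0)%C = 0 :> R[i] by [].
  by rewrite expc0 mulr1.
have -> : expc (0 +i* root_angle n j.+1)%C =
    expc (0 +i* root_angle n j)%C * expc (0 +i* (2 * pi / n%:R))%C :> R[i].
  rewrite -expcD; congr expc; apply/eqP; rewrite eq_complex /= addr0 eqxx/=.
  by rewrite /root_angle -natr1 mulrDl mul1r.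
by rewrite mulrA J_rotate// normcM normc_expc /= expR0 mulr1.
Qed.

(** By rotation invariance [n] times each mean is the integral of the sum over the [n]-th roots of
    unity, to which [rotation_mean_le] applies pointwise. *)
Let disc_mean_le (rho r : R) : 0 <= rho -> rho <= r -> 0 < r -> r < 1 ->
  (J rho%:C%C <= J r%:C%C)%E.
Proof.
move=> rho0 rhor r0 r1; apply/lee_addgt0Pr => e e0.
(* The area of the unit disc is at most 4, so a pointwise error [n * (e / 4)] integrates to at most
   [n * e]. *)
have e40 : 0 < e / 4 by rewrite divr_gt0.
have cE z : normc z <= r -> ccont E z.
  by move=> zr; apply/holo_ccont/hE/(le_lt_trans zr).
have [d d0 Hd] : exists2 d, 0 < d & forall z w, normc z <= r ->
    normc (w - z) < d -> normc (E w - E z) < e / 4.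
  have [|d d0 H] := @ccompact_uniform R [set z | normc (z - 0) <= r] E _
    (@ccompact_disc R 0 r) _ e40; first by move=> z /=; rewrite subr0 => /cE.
  by exists d => // z w zr; apply: H; rewrite /= subr0.
pose d1 := Num.min d 1; have d10 : 0 < d1 by rewrite lt_min d0/=.
have pi0 := @pi_gt0 R.
pose n := (Num.truncn (2 * pi / d1)).+1.
have nR0 : 0 < n%:R :> R by rewrite ltr0n.
have nd1 : 2 * pi / n%:R < d1.
  rewrite ltr_pdivrMr// [d1 * _]mulrC -ltr_pdivrMr//.
  have /truncn_itv/andP[_] : 0 <= 2 * pi / d1 by apply: divr_ge0; [rewrite mulr_ge0// ltW|exact: ltW].
  exact.
have nd : 2 * pi / n%:R < d by rewrite (lt_le_trans nd1)// ge_min lexx.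
have n1 : 2 * pi / n%:R < 1 :> R by rewrite (lt_le_trans nd1)// ge_min lexx orbT.
have rho1 : normc rho%:C%C < 1 by rewrite normc_real ger0_norm// (le_lt_trans rhor).
have rC1 : normc r%:C%C < 1 by rewrite normc_real gtr0_norm.
have nE0 : (0 < n%:R%:E :> \bar R)%E by rewrite lte_fin.
rewrite -(lee_pmul2l _ nE0)//.
pose l j := expc (0 +i* root_angle n j)%C : R[i].
have sumJ (c : R[i]) : normc c < 1 -> (n%:R%:E * J c =
    \int[mu2]_p \sum_(j < n) dilate (c * l j)%R p)%E.
  move=> c1.
  have c1' j : normc (c * l j) < 1 by rewrite normcM normc_expc /= expR0 mulr1.
  rewrite ge0_integral_sum//; last by move=> j; exact: measurable_dilate.
  rewrite (eq_bigr (fun=> J c)); last by move=> j _; exact: J_root.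
  by rewrite sumr_const card_ord mule_natl.
have J0 c : (0 <= J c)%E by apply: integral_ge0.
have eE0 : (0 <= e%:E)%E by rewrite lee_fin ltW.
rewrite [leRHS](ge0_muleDr _ (J0 _) eE0).
rewrite !sumJ//.
pose h p : \bar R := ((n%:R * (e / 4))%R%:E * (\1_(disc 1) p)%:E)%E.
have ne0 : 0 <= n%:R * (e / 4) by rewrite mulr_ge0// ltW.
have mh : @measurable_fun _ _ T2 _ setT h.
  apply/measurable_EFinP/measurable_funM => //.
  by apply: measurable_indic; exact: (@measurable_disc 1).
have h0 p : (0 <= h p)%E by rewrite /h -EFinM lee_fin mulr_ge0.
have intE : (\int[mu2]_p h p <= n%:R%:E * e%:E)%E.
  rewrite ge0_integralZl//; last first.
    apply/measurable_EFinP; apply: measurable_indic; exact: (@measurable_disc 1).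
  rewrite integral_indic//; last exact: (@measurable_disc 1).
  rewrite setIT; apply: le_trans (_ : _ <= (n%:R * (e / 4))%R%:E * 4%:E)%E _.
    by apply: lee_pmul => //; exact: mu2_disc_le.
  by rewrite -!EFinM lee_fin -mulrA divfK.
have c1 j (c : R) : normc c%:C%C < 1 -> normc (c%:C%C * l j) < 1.
  by move=> ?; rewrite normcM normc_expc /= expR0 mulr1.
have mS (c : R) : normc c%:C%C < 1 ->
    @measurable_fun _ _ T2 _ setT (fun p => \sum_(j < n) dilate (c%:C%C * l j)%R p)%E.
  move=> ?; apply: emeasurable_sum => j; apply: measurable_dilate; exact: c1.
apply: (@le_trans _ _ (\int[mu2]_p (\sum_(j < n) dilate (r%:C%C * l j)%R p + h p))%E).
  apply: ge0_le_integral => //.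
  - by move=> p _; apply: sume_ge0.
  - exact: mS.
  - by apply: emeasurable_funD => //; exact: mS.
  - move=> p _.
    have [p1|p1] := boolP (normc (pt p) <= 1); last first.
      by rewrite !big1 ?add0e ?h0// => j _; rewrite dilateE (negbTE p1).
    have -> : h p = (n%:R * (e / 4))%:E.
      by rewrite /h indicE (mem_set (p1 : disc 1 p)) mule1.
    rewrite (eq_bigr (fun j : 'I_n => (normc (E (rho%:C%C * (l j * pt p))))%:E)); last first.
      by move=> j _; rewrite dilateE p1 mulrA.
    rewrite [in leRHS](eq_bigr (fun j : 'I_n => (normc (E (r%:C%C * (l j * pt p))))%:E)); last first.
      by move=> j _; rewrite dilateE p1 mulrA.
    rewrite !sumEFin -EFinD lee_fin.
    exact: (@rotation_mean_le R E r (e / 4) d).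
rewrite ge0_integralD//; last first.
- exact: mS.
- by move=> p _; apply: sume_ge0.
by rewrite leeD2l.
Qed.

Let measurable_E rho : rho < 1 ->
  @measurable_fun _ _ T2 (measurableTypeR R) (disc rho) (fun p => normc (E (pt p))).
Proof.
move=> rho1; apply: measurable_funS (measurable_normc (@plane_open_disc 1) _).
- exact: measurable_open_disc.
- by move=> p /= /le_lt_trans; exact.
- by move=> z /hE/holo_ccont.
Qed.

Let disc_integral_dilation rho : 0 < rho -> rho < 1 ->
  (\int[mu2]_(p in disc rho) (normc (E (pt p)))%:E =
   (rho ^+ 2)%:E * J rho%:C%C)%E.
Proof.
move=> rho0 rho1; rewrite integral_mkcond.
rewrite (integral_dilation _ _ rho0); last first.
- by move=> p; apply: erestrict_ge0 => q _; rewrite lee_fin normc_ge0.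
- apply/(measurable_restrictT _ (@measurable_disc rho)).
  by apply/measurable_EFinP; exact: measurable_E.
congr (_ * _)%E; apply: eq_integral => p _; rewrite dilateE patchE.
have -> : (rho * p.1 + 0 * p.2, 0 * p.1 + rho * p.2) = (rho * p.1, rho * p.2).
  by rewrite !mul0r addr0 add0r.
have E1 : pt (rho * p.1, rho * p.2) = rho%:C%C * pt p.
  by apply/eqP; rewrite eq_complex /=; apply/andP; split; apply/eqP; ring.
by rewrite mem_disc E1 normcM normc_real gtr0_norm// ger_pMr.
Qed.

Let disc_integral_fin rho : rho < 1 ->
  (\int[mu2]_(p in disc rho) (normc (E (pt p)))%:E < +oo)%E.
Proof.
move=> rho1; have [|M M0 HM] := @holo_bounded_disc R E 0 rho.
  by move=> z; rewrite subr0 => /le_lt_trans/(_ rho1)/hE/holo_ccont.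
apply: (@le_lt_trans _ _ (\int[mu2]_(p in disc rho) M%:E)%E).
  apply: ge0_le_integral => //.
  - exact: measurable_disc.
  - by move=> p _; rewrite lee_fin normc_ge0.
  - by apply/measurable_EFinP; exact: measurable_E.
  - by move=> p pd; rewrite lee_fin HM// subr0.
rewrite integral_cst; last exact: measurable_disc.
apply: (@le_lt_trans _ _ (M%:E * 4%:E)%E); last by rewrite -EFinM ltry.
apply: lee_pmul => //.
apply: le_trans mu2_disc_le; apply: le_measure; rewrite ?inE.
- exact: measurable_disc.
- exact: measurable_disc.
- by move=> p /= /le_trans; apply; exact: ltW.
Qed.

Lemma disc_integral_le rho r : 0 < rho -> rho <= r -> r < 1 ->
  ((r ^+ 2)%:E * \int[mu2]_(p in disc rho) (normc (E (pt p)))%:E <=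
   (rho ^+ 2)%:E * \int[mu2]_(p in disc r) (normc (E (pt p)))%:E)%E.
Proof.
move=> rho0 rhor r1; have r0 := lt_le_trans rho0 rhor.
rewrite !disc_integral_dilation// ?(le_lt_trans rhor)// !muleA (muleC (rho ^+ 2)%:E).
apply: lee_pmul => //.
- by rewrite -EFinM lee_fin mulr_ge0// sqr_ge0.
- exact: integral_ge0.
- by apply: disc_mean_le => //; exact: ltW.
Qed.

(** With [I r] the integral over radius [r], monotone means give [I 0.3 <= (0.09 / 0.49) I 0.7] and
    [I 0.21 <= (0.0441 / 0.49) I 0.7]; hence [I 0.7 - I 0.3 >= (0.4 / 0.49) I 0.7 >= (0.4 / 0.0441)
    I 0.21]. *)
Lemma annulus_integral_le :
  ((40%:R / 21%:R * (100%:R / 21%:R))%:E *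
     \int[mu2]_(p in disc (21%:R / 100%:R)) (normc (E (pt p)))%:E <=
   \int[mu2]_(p in disc (7%:R / 10%:R) `\` disc (3%:R / 10%:R))
     (normc (E (pt p)))%:E)%E.
Proof.
pose I (A : set (R * R)) := (\int[mu2]_(p in A) (normc (E (pt p)))%:E)%E.
rewrite -!/(I _).
have I0 A : (0 <= I A)%E by apply: integral_ge0 => p _; rewrite lee_fin normc_ge0.
have I7 : I (disc (7 / 10)) =
    (I (disc (3 / 10)) + I (disc (7 / 10) `\` disc (3 / 10)))%E.
  have {1}-> : disc (7 / 10) = disc (3 / 10) `|` (disc (7 / 10) `\` disc (3 / 10)).
    apply/seteqP; split => p; rewrite /disc /=; last by case=> [?|[]//]; lra.
    by have [|] := boolP (normc (pt p) <= 3 / 10); [left|right; split => //; exact/negP].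
  rewrite /I ge0_integral_setU//.
  - exact: measurable_disc.
  - by apply: measurableD; exact: measurable_disc.
  - apply/measurable_EFinP; apply: measurable_funS (measurable_E (rho := 7 / 10) _).
    + exact: measurable_disc.
    + by move=> p [|[]//]; rewrite /disc /=; lra.
    + lra.
  - by move=> p _; rewrite lee_fin normc_ge0.
  - by apply/disj_setPS => p [? []].
have h1 : ((49/100)%:E * I (disc (3 / 10)) <= (9/100)%:E * I (disc (7/10)))%E.
  have := @disc_integral_le (3/10) (7/10) _ _ _; rewrite -!/(I _).
  have -> : (7 / 10) ^+ 2 = 49 / 100 :> R by lra.
  have -> : (3 / 10) ^+ 2 = 9 / 100 :> R by lra.
  by apply; lra.
have h2 : ((49/100)%:E * I (disc (21 / 100)) <= (441/10000)%:E * I (disc (7/10)))%E.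
  have := @disc_integral_le (21/100) (7/10) _ _ _; rewrite -!/(I _).
  have -> : (7 / 10) ^+ 2 = 49 / 100 :> R by lra.
  have -> : (21 / 100) ^+ 2 = 441 / 10000 :> R by lra.
  by apply; lra.
have F c : c < 1 -> exists2 x, 0 <= x & I (disc c) = x%:E.
  move=> c1; have : I (disc c) \is a fin_num.
    by rewrite ge0_fin_numE//; exact: disc_integral_fin.
  move=> /fineK <-; exists (fine (I (disc c))) => //; exact: fine_ge0.
have [|a a0 Ia] := F (3/10); first lra.
have [|b b0 Ib] := F (21/100); first lra.
have [|k k0 Ik] := F (7/10); first lra.
move: I7 h1 h2; rewrite Ia Ib Ik.
case: (I (_ `\` _)) (I0 (disc (7 / 10) `\` disc (3 / 10))) => // x _.
rewrite -EFinD -!EFinM => -[kE]; rewrite !lee_fin; lra.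
Qed.

End disc_means.
End plane_measurability.

(** * Comparison of the Bergman norms *)

Section base_point.
Context {R : realType}.
Implicit Types (z w p : R[i]) (f g : R[i] -> R[i]) (r : R).

(** Maximum principle with bound 0 on a circle inside the annulus. *)
Lemma annulus_vanish f r : 0 < r -> r < 1 ->
  (forall z, normc z < 1 -> holo f z) ->
  (forall z, r < normc z -> normc z < 1 -> f z = 0) ->
  forall z, normc z < 1 -> f z = 0.
Proof.
move=> r0 r1 hf f0 z z1; have [rz|zr] := ltP r (normc z); first exact: f0.
pose s := (r + 1) / 2.
have rs : r < s by rewrite /s; lra.
have s1 : s < 1 by rewrite /s; lra.
apply/eqP; rewrite -normc_eq0 eq_le normc_ge0 andbT.
apply: (@maximum_modulus_disc R f 0 s) => //.
- by move=> w; rewrite subr0 => ws; apply/holo_ccont/hf/(le_lt_trans ws).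
- by move=> w; rewrite subr0 => ws _; apply/hf/(le_lt_trans ws).
- by move=> w; rewrite subr0 => ws; rewrite f0 ?normc0 ?ws.
- by rewrite subr0; apply: le_trans zr _; exact: ltW.
Qed.

(** Without such a [p], the product [g z * g (- z)] vanishes on the circle, hence inside. If
    [g z1 != 0], then [g] vanishes near [- z1], and the zeros propagate from there. *)
Lemma antipodal_nonzero g r : 0 < r -> r < 1 / 2 ->
  (forall z, normc z < 1 -> holo g z) ->
  (forall z, normc z < 1 -> g z = 0) \/
  exists p, [/\ normc p = r, g p != 0 & g (- p) != 0].
Proof.
move=> r0 r2 hg.
have [|noP] := pselect (exists p, [/\ normc p = r, g p != 0 & g (- p) != 0]).
  by right.
left.
have hgN z : normc z < 1 -> holo (fun z => g (- z)) z.
  move=> z1; apply: (@holo_comp R (fun z => - z) g).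
    by apply: holoN; exact: holo_id.
  by apply: hg; rewrite normcN.
have r1 : r < 1 by lra.
have prod0 z : normc z <= r -> g z * g (- z) = 0.
  move=> zr; apply/eqP; rewrite -normc_eq0 eq_le normc_ge0 andbT.
  apply: (@maximum_modulus_disc R (fun z => g z * g (- z)) 0 r) => //.
  - move=> w; rewrite subr0 => wr; apply: holo_ccont.
    by apply: holoM; [apply: hg|apply: hgN]; exact: le_lt_trans r1.
  - move=> w; rewrite subr0 => wr _.
    by apply: holoM; [apply: hg|apply: hgN]; exact: le_lt_trans r1.
  - move=> w; rewrite subr0 => wr; rewrite normcM.
    have [->|gw] := eqVneq (g w) 0; first by rewrite normc0 mul0r.
    have [->|gNw] := eqVneq (g (- w)) 0; first by rewrite normc0 mulr0.
    by case: noP; exists w.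
  - by rewrite subr0.
have hg0 z : normc (z - 0) < 1 -> holo g z by rewrite subr0; exact: hg.
suff [d d0 g0] : exists2 d, 0 < d & forall z, normc (z - 0) < d -> g z = 0.
  by move=> z z1; apply: (holo_disc_vanish d0 hg0 g0); rewrite subr0.
have [[z1 z1r gz1]|H] := pselect (exists2 z, normc z < r & g z != 0); last first.
  exists r => // z; rewrite subr0 => zr; apply/eqP/negP => /negP gz.
  by apply: H; exists z.
have gz10 : 0 < normc (g z1) by rewrite normc_gt0.
have z11 : normc z1 < 1 by exact: lt_trans r1.
have [d d0 Hd] := holo_ccont (hg _ z11) gz10.
have m0 : 0 < Num.min d (r - normc z1) by rewrite lt_min d0 subr_gt0.
(* The zeros fill the disc of radius [1 - |z1|] about [- z1], which contains the disc of this radius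
   about 0; positivity is where [r < 1 / 2] enters. *)
exists (1 - normc z1 - normc z1); first lra.
move=> z; rewrite subr0 => zd.
apply: (@holo_disc_vanish R g (- z1) (1 - normc z1) (Num.min d (r - normc z1)) m0).
- move=> w; rewrite opprK => wz; apply: hg.
  rewrite -(addrK z1 w); apply: le_lt_trans (le_normcB _ _) _; lra.
- move=> w; rewrite opprK lt_min => /andP[wd wr].
  have gNw : g (- w) != 0.
    rewrite -normc_gt0; have := Hd (- w).
    rewrite -opprD normcN => /(_ wd) h.
    have := normc_le_dist (g z1) (g (- w)); rewrite normcBC; lra.
  have wr1 : normc w <= r.
    rewrite -(addrK z1 w); apply: le_trans (le_normcB _ _) _; lra.
  by apply/eqP; move/eqP: (prod0 _ wr1); rewrite mulf_eq0 (negbTE gNw) orbF.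
- rewrite opprK; apply: le_lt_trans (le_normcD _ _) _; lra.
Qed.

End base_point.

Section bergman_comparison.
Context {R : realType}.
Local Notation mu2 := ((@lebesgue_measure R \x @lebesgue_measure R)%E).
Local Notation T2 := (measurableTypeR R * measurableTypeR R)%type.
Local Notation c := (21%:R / 100%:R : R).
Local Notation U := [set p : R * R | unit_disk (p.1 +i* p.2)%C].
Implicit Types (f g : R[i] -> R[i]) (A : set (R * R)).

Let sqint f A := (\int[mu2]_(p in A) (normc (f (p.1 +i* p.2)%C) ^+ 2)%:E)%E.

Let sqint_ge0 f A : (0 <= sqint f A)%E.
Proof. by apply: integral_ge0 => p _; rewrite lee_fin sqr_ge0. Qed.

Let mU : measurable (U : set T2).
Proof. exact: measurable_open_disc. Qed.

Let measurable_sq f A : (forall z, normc z < 1 -> holo f z) ->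
  measurable (A : set T2) -> A `<=` U ->
  @measurable_fun _ _ T2 _ A (fun p => (normc (f (p.1 +i* p.2)%C) ^+ 2)%:E).
Proof.
move=> hf mA AU; apply/measurable_EFinP/measurable_funX.
apply: measurable_funS (measurable_normc (@plane_open_disc R 1) _) => //.
by move=> z /hf/holo_ccont.
Qed.

Let sqint_split f A B : (forall z, normc z < 1 -> holo f z) ->
  measurable (A : set T2) -> measurable (B : set T2) -> A `<=` U -> B `<=` U ->
  [disjoint A & B] -> sqint f (A `|` B) = (sqint f A + sqint f B)%E.
Proof.
move=> hf mA mB AU BU AB; rewrite /sqint ge0_integral_setU//.
- by apply: measurable_sq => //; [exact: measurableU|move=> p [/AU|/BU]].
- by move=> p _; rewrite lee_fin sqr_ge0.
Qed.

Lemma sqintZ f a A : (forall z, normc z < 1 -> holo f z) -> 0 <= a ->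
  measurable (A : set T2) -> A `<=` U ->
  (\int[mu2]_(p in A) (a * normc (f (p.1 +i* p.2)%C) ^+ 2)%:E = a%:E * sqint f A)%E.
Proof.
move=> hf a0 mA AU; under eq_integral do rewrite EFinM.
rewrite ge0_integralZl//; first exact: measurable_sq.
by move=> p _; rewrite lee_fin sqr_ge0.
Qed.

(** The gap inequalities are integrated in additive form, so that every integrand is nonnegative and
    nothing is subtracted in the extended reals. *)
Let sqintZD f E a A : (forall z, normc z < 1 -> holo f z) ->
  (forall z, normc z < 1 -> holo E z) -> 0 <= a ->
  measurable (A : set T2) -> A `<=` U ->
  (\int[mu2]_(p in A) (a * normc (f (p.1 +i* p.2)%C) ^+ 2 + normc (E (p.1 +i* p.2)%C))%:E =
   a%:E * sqint f A + \int[mu2]_(p in A) (normc (E (p.1 +i* p.2)%C))%:E)%E.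
Proof.
move=> hf hE a0 mA AU; under eq_integral do rewrite EFinD.
rewrite ge0_integralD//; last first.
- apply/measurable_EFinP.
  apply: measurable_funS (measurable_normc (@plane_open_disc R 1) _) => //.
  by move=> z /hE/holo_ccont.
- by move=> p _; rewrite lee_fin normc_ge0.
- under eq_fun do rewrite EFinM.
  by apply: measurable_funeM; exact: measurable_sq.
- by move=> p _; rewrite lee_fin mulr_ge0// sqr_ge0.
by rewrite sqintZ.
Qed.

Let measurable_sqZ f a A : (forall z, normc z < 1 -> holo f z) ->
  measurable (A : set T2) -> A `<=` U ->
  @measurable_fun _ _ T2 _ A (fun p => (a * normc (f (p.1 +i* p.2)%C) ^+ 2)%:E).
Proof.
move=> hf mA AU; under eq_fun do rewrite EFinM.
by apply: measurable_funeM; exact: measurable_sq.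
Qed.

Let measurable_sqZD f E a A : (forall z, normc z < 1 -> holo f z) ->
  (forall z, normc z < 1 -> holo E z) ->
  measurable (A : set T2) -> A `<=` U ->
  @measurable_fun _ _ T2 _ A
    (fun p => (a * normc (f (p.1 +i* p.2)%C) ^+ 2 + normc (E (p.1 +i* p.2)%C))%:E).
Proof.
move=> hf hE mA AU; under eq_fun do rewrite EFinD.
apply: emeasurable_funD; first exact: measurable_sqZ.
apply/measurable_EFinP.
apply: measurable_funS (measurable_normc (@plane_open_disc R 1) _) => //.
by move=> z /hE/holo_ccont.
Qed.

Lemma sqint_le f g p :
  (forall z, normc z < 1 -> holo f z) -> (forall z, normc z < 1 -> holo g z) ->
  (forall z, c < normc z -> normc z < 1 -> normc (f z) <= normc (g z)) ->
  normc p ^+ 2 = c -> 0 < gap f g p -> 0 < gap f g (- p) ->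
  (sqint f U <= sqint g U)%E.
Proof.
move=> hf hg hfg npc gp gNp.
pose k := Num.sqrt (gap f g p * gap f g (- p)).
have k0 : 0 < k by rewrite sqrtr_gt0 mulr_gt0.
have k0' := ltW k0.
pose N : R := 40 / 21 * (100 / 21).
have N0 : 0 < N by rewrite /N; lra.
pose E z := wronskian f g p z * wronskian f g (- p) z.
have hE z : normc z < 1 -> holo E z.
  by move=> z1; apply: holoM; apply: holoB; apply: holoM;
    [exact: hf|exact: holo_cst|exact: hg|exact: holo_cst|
     exact: hf|exact: holo_cst|exact: hg|exact: holo_cst].
pose K : set (R * R) := disc c.
pose A : set (R * R) := disc (7 / 10) `\` disc (3 / 10).
pose I S := (\int[mu2]_(q in S) (normc (E (pt q)))%:E)%E.
have I0 S : (0 <= I S)%E by apply: integral_ge0 => q _; rewrite lee_fin normc_ge0.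
have mK : measurable (K : set T2) by exact: measurable_disc.
have mA : measurable (A : set T2) by apply: measurableD; exact: measurable_disc.
have KU : K `<=` U by move=> q /= /le_lt_trans; apply; lra.
have AU : A `<=` U by move=> q [/= /le_lt_trans + _]; apply; lra.
have KA : [disjoint K & A].
  apply/disj_setPS => q [] /= qK [_] /=; apply; apply: le_trans qK _; lra.
have hK : (k%:E * sqint f K <= k%:E * sqint g K + I K)%E.
  rewrite /I -sqintZ// -(sqintZD _ hE)//; apply: ge0_le_integral => //.
  - by move=> q _; rewrite lee_fin mulr_ge0// sqr_ge0.
  - exact: measurable_sqZ.
  - exact: measurable_sqZD.
  - move=> q _; rewrite lee_fin.
    have := gap_le_wronskian (q.1 +i* q.2)%C gp gNp; rewrite -/k /gap -/(E _).
    by rewrite mulNr mulrBl ![_ * k]mulrC; lra.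
have hA : ((N * k)%:E * sqint f A + I A <= (N * k)%:E * sqint g A)%E.
  have Nk0 : 0 <= N * k by rewrite ltW// mulr_gt0.
  rewrite /I -(sqintZ hg)// -(sqintZD hf hE)//; apply: ge0_le_integral => //.
  - by move=> q _; rewrite lee_fin addr_ge0 ?normc_ge0// mulr_ge0// sqr_ge0.
  - exact: measurable_sqZD.
  - exact: measurable_sqZ.
  - move=> q [q7 q3]; rewrite lee_fin.
    have := @wronskian_product_le R f g p (q.1 +i* q.2)%C hf hg hfg npc gp gNp _.
    rewrite -/k -/(E _) -/N /gap mulrBr mulrBr !(mulrA N).
    have q3' : 3 / 10 <= normc (q.1 +i* q.2)%C <= 7 / 10.
      by rewrite q7 andbT ltW// ltNge; exact/negP.
    by move=> /(_ q3'); lra.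
have hI : (N%:E * I K <= I A)%E by exact: annulus_integral_le.
pose S := K `|` A.
have mS : measurable (S : set T2) by exact: measurableU.
have SU : S `<=` U by move=> q [/KU|/AU].
(* [N] times [hK], added to [hA]: the term [N * I K] gained on the small disc is paid for by
   [I A]. *)
have hS : (sqint f S <= sqint g S)%E.
  have Nk0 : 0 < N * k by rewrite mulr_gt0.
  rewrite -(@lee_pmul2l _ (N * k)%:E)//.
  rewrite !sqint_split// !(ge0_muleDr _ (sqint_ge0 _ _) (sqint_ge0 _ _)).
  apply: (@le_trans _ _ (N%:E * (k%:E * sqint g K + I K) + (N * k)%:E * sqint f A)%E).
    by rewrite leeD2r// EFinM -muleA lee_wpmul2l// lee_fin ltW.
  rewrite (ge0_muleDr _ (mule_ge0 (_ : 0 <= k%:E)%E (sqint_ge0 _ _)) (I0 _))//.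
  rewrite muleA -EFinM -addeA leeD2l//; apply: le_trans hA.
  by rewrite addeC leeD2l.
have -> : U = S `|` (U `\` S) by rewrite setDUK.
have mUS : measurable (U `\` S : set T2) by exact: measurableD.
have USU : U `\` S `<=` U by move=> q [].
have dUS : [disjoint S & U `\` S] by apply/disj_setPS => q [? []].
rewrite (sqint_split hf mS mUS)// (sqint_split hg mS mUS)//; apply: leeD => //.
rewrite /sqint; apply: ge0_le_integral => //.
- by move=> q _; rewrite lee_fin sqr_ge0.
- exact: measurable_sq.
- exact: measurable_sq.
- move=> q [qU qS]; rewrite lee_fin lerXn2r ?nnegrE ?normc_ge0//.
  apply: hfg => //; rewrite ltNge; apply/negP => qc; apply: qS; left.
  exact: qc.
Qed.

End bergman_comparison.

Unset Implicit Arguments.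

Theorem mainTheorem1 (R : realType) (f g : R[i] -> R[i])
  (hf : analytic_in_disk f) (hg : analytic_in_disk g)
  (hfg : forall z : R[i],
      21%:R / 100%:R < normc z -> normc z < 1 -> normc (f z) <= normc (g z)) :
  (bergman_norm f <= bergman_norm g)%E.
Proof.
have {}hf z : normc z < 1 -> holo f z by move=> z1; exact/derivable_holo/hf.
have {}hg z : normc z < 1 -> holo g z by move=> z1; exact/derivable_holo/hg.
rewrite /bergman_norm.
set F := (\int[_]_(_ in _) (normc (f _) ^+ 2)%:E)%E.
set G := (\int[_]_(_ in _) (normc (g _) ^+ 2)%:E)%E.
have F0 : (0 <= F)%E by apply: integral_ge0 => p _; rewrite lee_fin sqr_ge0.
have G0 : (0 <= G)%E by apply: integral_ge0 => p _; rewrite lee_fin sqr_ge0.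
have pi0 : (0 <= (pi^-1)%:E :> \bar R)%E by rewrite lee_fin invr_ge0 pi_ge0.
suff FG : (F <= G)%E.
  by apply: gt0_ler_poweR; rewrite ?in_itv/= ?invr_ge0 ?leey ?mule_ge0// lee_wpmul2l.
pose c : R := 21 / 100.
have c0 : 0 < c by rewrite /c; lra.
(* The base points have modulus [Num.sqrt c]: below [1 / 2] as [antipodal_nonzero] requires, and
   above [c], so that [hfg] applies at them. *)
have c2 : Num.sqrt c < 1 / 2.
  rewrite -[1/2]ger0_norm; last lra.
  by rewrite -sqrtr_sqr ltr_sqrt /c; lra.
have cc : c < Num.sqrt c.
  rewrite -[c in c < _]ger0_norm; last exact: ltW.
  by rewrite -sqrtr_sqr ltr_sqrt /c; lra.
have sc0 : 0 < Num.sqrt c by rewrite sqrtr_gt0.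
have [g0|[p [pc gp gNp]]] := antipodal_nonzero sc0 c2 hg.
- have f0 : forall z, normc z < 1 -> f z = 0.
    apply: (annulus_vanish c0 _ hf) => [|z cz z1]; first by rewrite /c; lra.
    apply/eqP; rewrite -normc_eq0 eq_le normc_ge0 andbT.
    by rewrite (le_trans (hfg _ cz z1))// g0// normc0.
  suff -> : F = 0%E by [].
  by apply: integral0_eq => p pU; rewrite f0// normc0 expr0n.
(* Replacing [f] by [sqrt x * f] with [0 < x < 1] makes the gap positive at [p] and [- p]. *)
apply/lee_mul01Pr => // x /andP[x0 x1].
have sx1 : Num.sqrt x <= 1 by rewrite -sqrtr1 ler_wsqrtr// ltW.
pose h z := (Num.sqrt x)%:C%C * f z.
have hh z : normc z < 1 -> holo h z.
  by move=> z1; apply: holoM; [exact: holo_cst|exact: hf].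
have nh z : normc (h z) = Num.sqrt x * normc (f z).
  by rewrite normcM normc_real ger0_norm// sqrtr_ge0.
have hhg z : c < normc z -> normc z < 1 -> normc (h z) <= normc (g z).
  move=> cz z1; apply: le_trans (hfg z cz z1).
  by rewrite nh ler_piMl// normc_ge0.
have gap_gt0 q : normc q = Num.sqrt c -> g q != 0 -> 0 < gap h g q.
  move=> qc gq; rewrite /gap nh exprMn sqr_sqrtr ?ltW// subr_gt0.
  have fg : normc (f q) ^+ 2 <= normc (g q) ^+ 2.
    by rewrite lerXn2r ?nnegrE ?normc_ge0// hfg ?qc//; lra.
  apply: (@le_lt_trans _ _ (x * normc (g q) ^+ 2)); first by rewrite ler_wpM2l// ltW.
  by rewrite gtr_pMl// exprn_gt0// normc_gt0.
have -> : (x%:E * F = \int[@lebesgue_measure R \x @lebesgue_measure R]_(p in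
    [set p : R * R | unit_disk (p.1 +i* p.2)%C]) (normc (h (p.1 +i* p.2)%C) ^+ 2)%:E)%E.
  rewrite -sqintZ ?ltW//; last exact: measurable_open_disc.
  by apply: eq_integral => q _; rewrite nh exprMn sqr_sqrtr// ltW.
apply: (sqint_le hh hg hhg (p := p)).
- by rewrite pc sqr_sqrtr// ltW.
- exact: gap_gt0.
- by apply: gap_gt0; rewrite ?normcN.
Qed.
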